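(* If $\epsilon<|1-\delta|/(\delta+\theta)$, then for all $u\ge0$ the corrected replace approximation $\tilde\psi_{r,\epsilon}(u)$ satisfies $$|\psi_\epsilon(u)-\tilde\psi_{r,\epsilon}(u)|\le\left(\frac{\epsilon}{1-\delta}\right)^2(\delta+\theta)^2\,\frac{1-\delta}{1-\delta-\epsilon(\delta+\theta)}.$$
   Context: Fix $\lambda>0$ and $\epsilon\in[0,1]$. Let $B$ be a nonnegative random variable with a phase-type distribution and $C$ a nonnegative random variable with a heavy-tailed distribution ($\mathbb{E}e^{rC}=\infty$ for all $r>0$), both with finite positive means. Classical Cramér–Lundberg model: premiums flow in at rate 1, claims arrive according to a Poisson process $\{N_\epsilon(t)\}$ of rate $\lambda$, and the claim sizes $U_{\epsilon,i}$ are i.i.d., independent of $N_\epsilon$, distributed as $B$ with probability $1-\epsilon$ and as $C$ with probability $\epsilon$. Let $M_\epsilon=\sup_{t\ge0}\big(\sum_{i=1}^{N_\epsilon(t)}U_{\epsilon,i}-t\big)$ and let $\psi_\epsilon(u)=\mathbb{P}(M_\epsilon>u)$ be the ruin probability with initial capital $u\ge0$. Put $\delta=\lambda\mathbb{E}B$, $\theta=\lambda\mathbb{E}C$, $\rho_\epsilon=(1-\epsilon)\delta+\epsilon\theta$. Standing assumptions: $\rho_\epsilon<1$ and $\delta<1$. For a nonnegative random variable with distribution $F$ and mean $\mu_F\in(0,\infty)$, its stationary excess distribution is $F^e(u)=\frac1{\mu_F}\int_0^u(1-F(t))\,dt$; $B^e$, $C^e$ have the stationary excess distributions of $B$, $C$.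 Replace base model: $M_0$ and $\psi_0(u)=\mathbb{P}(M_0>u)$ are $M_\epsilon$ and $\psi_\epsilon$ for $\epsilon=0$. The $M_{0,i}$, $C^e_i$, $B^e_i$ are copies of $M_0$, $C^e$, $B^e$ respectively, all mutually independent. Corrected replace approximation: \begin{align*} \tilde\psi_{r,\epsilon}(u)=\psi_0(u)&+\frac{\epsilon\theta}{1-\delta}\big(\mathbb{P}(M_{0,0}+M_{0,1}+C^e_1>u)-\mathbb{P}(M_{0,0}>u)\big)\\ &-\frac{\epsilon\delta}{1-\delta}\big(\mathbb{P}(M_{0,0}+M_{0,1}+B^e_1>u)-\mathbb{P}(M_{0,0}>u)\big). \end{align*} *)

(* Defs.v *)
From mathcomp Require Export all_boot all_order all_algebra.
From mathcomp Require Export all_classical all_reals all_analysis.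
(* all_analysis does not export the Borel structure on \bar R. *)
From mathcomp Require Export measurable_realfun.

Set Implicit Arguments.
Unset Strict Implicit.
Unset Printing Implicit Defensive.

Import Order.TTheory GRing.Theory Num.Theory.
Import numFieldNormedType.Exports.

Local Open Scope classical_set_scope.
Local Open Scope ring_scope.

Definition expmx (R : realType) (n : nat) (A : 'M[R]_n.+1) : 'M[R]_n.+1 :=
  limn (series (fun k => (k`!%:R)^-1 *: A ^+ k)).

(* Intensity matrix of a Markov jump process restricted to its transient
   states; invertibility says that absorption is certain from every state. *)
Definition subgenerator (R : realType) (n : nat) (S : 'M[R]_n.+1) : Prop :=
  [/\ forall i j, i != j -> 0 <= S i j,
      forall i, \sum_j S i j <= 0
    & S \in unitmx].

Section Distributions.
Context d (T : measurableType d) (R : realType) (P : probability T R).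

(* B is the absorption time of a Markov jump process with n.+1 transient states
   and one absorbing state, initial law alpha on the transient states
   (starting absorbed has probability 1 - \sum_i alpha 0 i) and
   subgenerator S. *)
Definition phase_type (B : {RV P >-> R}) : Prop :=
  exists (n : nat) (alpha : 'rV[R]_n.+1) (S : 'M[R]_n.+1),
    [/\ forall i, 0 <= alpha 0 i,
        \sum_i alpha 0 i <= 1,
        subgenerator S
      & forall u : R, 0 <= u ->
          ccdf B u =
            ((alpha *m expmx (u *: S) *m (const_mx 1 : 'cV[R]_n.+1)) 0 0)%:E].

Definition heavy_tailed (C : {RV P >-> R}) : Prop :=
  forall r : R, 0 < r -> 'M_P C r = +oo%E.

(* Y has the stationary excess distribution of X. *)
Definition has_excess_law (X Y : {RV P >-> R}) : Prop :=
  forall u : R, 0 <= u ->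
    cdf Y u = (((fine 'E_P[X])^-1)%:E *
               \int[lebesgue_measure]_(t in `[0%R, u]) (1 - cdf X t))%E.

Definition mutually_independent (I : eqType) (X : I -> {RV P >-> R}) : Prop :=
  forall (J : seq I) (A : I -> set R), uniq J ->
    (forall i, measurable (A i)) ->
    P (\bigcap_(i in [set` J]) (X i @^-1` A i)) =
    (\prod_(i <- J) P (X i @^-1` A i))%E.

(* The sigma-algebra generated by the family (X i), i \in D. *)
Definition sigma_of d' (T' : measurableType d') (I : Type) (D : set I)
    (X : I -> T -> T') : set (set T) :=
  <<s \bigcup_(i in D) preimage_set_system setT (X i) measurable >>.

Definition independent_systems (F G : set (set T)) : Prop :=
  forall A B, F A -> G B -> P (A `&` B) = (P A * P B)%E.

(* N is the counting process of a renewal sequence with i.i.d. exponential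
   interarrival times: the n-th arrival epoch is \sum_(i < n) tau i, and
   n <= N t iff it does not exceed t. *)
Definition poisson_process (lambda : R) (N : R -> T -> nat) : Prop :=
  exists tau : nat -> {RV P >-> R},
    [/\ forall i w, 0 <= tau i w,
        forall i A, measurable A ->
          distribution P (tau i) A = exponential_prob lambda A,
        mutually_independent tau
      & forall t w n, 0 <= t -> (n <= N t w)%N = (\sum_(i < n) tau i w <= t)].

(* Classical risk process with premium rate 1, arrival process N, and claim
   sizes U drawn from B with probability 1 - eps and from C with
   probability eps. *)
Definition cramer_lundberg (lambda eps : R) (B C : {RV P >-> R})
    (N : R -> T -> nat) (U : nat -> {RV P >-> R}) : Prop :=
  [/\ poisson_process lambda N,
      forall i A, measurable A ->
        distribution P (U i) A =
        ((1 - eps)%:E * distribution P B A + eps%:E * distribution P C A)%E,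
      mutually_independent U
    & independent_systems (sigma_of [set t : R | 0 <= t] N)
        (sigma_of [set: nat] (fun i => U i : T -> R))].

Definition max_loss (N : R -> T -> nat) (U : nat -> {RV P >-> R}) (w : T)
    : \bar R :=
  ereal_sup [set ((\sum_(i < N t w) U i w) - t)%:E | t in [set t : R | 0 <= t]].

Definition tail (X : T -> \bar R) (u : R) : R :=
  fine (P [set w | (u%:E < X w)%E]).

Definition ruin_prob (N : R -> T -> nat) (U : nat -> {RV P >-> R}) (u : R)
    : R :=
  tail (max_loss N U) u.

(* M is a copy of the extended-real variable Y; the supremum Y is a priori
   +oo on some event, which such an M forces to be null. *)
Definition copy_of (Y : T -> \bar R) (M : {RV P >-> R}) : Prop :=
  forall A : set (\bar R), measurable A ->
    P [set w | A (M w)%:E] = P (Y @^-1` A).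

(* N0, U0 is the model with eps = 0; M00, M01 are copies of its maximal
   aggregate loss, and Ce1, Be1 are stationary excess variables. *)
Definition corrected_replace (lambda eps : R) (B C : {RV P >-> R})
    (N0 : R -> T -> nat) (U0 : nat -> {RV P >-> R})
    (M00 M01 Ce1 Be1 : {RV P >-> R}) (u : R) : R :=
  let delta := lambda * fine 'E_P[B] in
  let theta := lambda * fine 'E_P[C] in
  ruin_prob N0 U0 u
  + eps * theta / (1 - delta) *
      (tail (fun w => (M00 w + M01 w + Ce1 w)%:E) u
       - tail (fun w => (M00 w)%:E) u)
  - eps * delta / (1 - delta) *
      (tail (fun w => (M00 w + M01 w + Be1 w)%:E) u
       - tail (fun w => (M00 w)%:E) u).

End Distributions.

Arguments phase_type {d T R} P B.
Arguments heavy_tailed {d T R} P C.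
Arguments has_excess_law {d T R} P X Y.
Arguments mutually_independent {d T R} P {I} X.
Arguments poisson_process {d T R} P lambda N.
Arguments cramer_lundberg {d T R} P lambda eps B C N U.
Arguments max_loss {d T R} P N U w.
Arguments tail {d T R} P X u.
Arguments ruin_prob {d T R} P N U u.
Arguments copy_of {d T R} P Y M.
Arguments corrected_replace {d T R} P lambda eps B C N0 U0 M00 M01 Ce1 Be1 u.

(* Main.v *)
(* Write phi(u) = P(M <= u). The maximal loss M is the maximum of the random
   walk with steps U_i - tau_i, because the supremum over t is approached at
   claim epochs. Conditioning on the first step and integrating the resulting
   identity over [0, u] gives the renewal equation phi = phi(0) + H * phi, where
   H has density lambda P(U > x) and mass rho. The finite-horizon analogue is an
   inequality, and letting u tend to infinity in it yields phi(0) >= 1 - rho, so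
   that M is finite without any appeal to the law of large numbers; hence
   phi(0) = 1 - rho.
   Let mu be the law of M_0 and a = eps / (1 - delta). Applying mu to both
   renewal equations eliminates H_0 and gives phi_eps = (1 - m) phi_0 +
   K phi_eps, where K f = a (theta mu * C^e * f - delta mu * B^e * f) and
   m = a (theta - delta), while the corrected replace approximation is
   (1 - m) phi_0 + K phi_0. In the sup norm K is a contraction of ratio
   q = a (delta + theta). As phi_eps - phi_0 = K phi_eps - m phi_0, its norm is
   at most q / (1 - q), and the error K (phi_eps - phi_0) is at most
   q^2 / (1 - q). *)
From HB Require Import structures.
From mathcomp Require Import ring lra.
Require Import Defs.
Import Order.TTheory GRing.Theory Num.Theory.
Import numFieldNormedType.Exports.
Set Implicit Arguments.
Unset Strict Implicit.
Unset Printing Implicit Defensive.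
Local Open Scope classical_set_scope.
Local Open Scope ring_scope.


(** * Lebesgue measure and laws on the real line *)

Section measure_tools.
Context {R : realType}.
Local Open Scope ereal_scope.
Notation mu := (@lebesgue_measure R).

Lemma integral_indicr d (T : measurableType d) (m : {measure set T -> \bar R})
    (D : set T) (f : T -> \bar R) :
  \int[m]_(x in D) f x = \int[m]_x (f x * (\1_D x)%:E).
Proof.
by rewrite integral_mkcond; apply: eq_integral => x _; rewrite epatch_indic.
Qed.

(** Lebesgue measure is determined by its values on half-open intervals, and a translation preserves
    their lengths. *)
Lemma lebesgue_measure_shift (c : R) (A : set R) : measurable A ->
  pushforward mu (fun x : measurableTypeR R => (x + c)%R : measurableTypeR R) A
  = mu A.
Proof.
move=> mA; apply/esym/lebesgue_measure_unique => //.
  exact: measurable_funD.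
move=> mc _ [[a b]] _ <-.
rewrite /= /pushforward.
rewrite (_ : _ @^-1` _ = `](a - c)%R, (b - c)%R]%classic); last first.
  by apply/seteqP; split=> x /=; rewrite !in_itv/= ltrBlDr lerBrDr.
rewrite !lebesgue_measure_itv/= !lte_fin ltrD2r -!EFinB.
by rewrite opprD addrACA subrr addr0.
Qed.

Lemma ge0_integral_shift (c : R) (f : R -> \bar R) :
  measurable_fun setT f -> (forall x, 0 <= f x) ->
  \int[mu]_x f (x + c)%R = \int[mu]_x f x.
Proof.
move=> mf f0.
transitivity (\int[pushforward mu
    (fun x : measurableTypeR R => (x + c)%R : measurableTypeR R)]_x f x).
  by rewrite ge0_integral_pushforward//=; exact: measurable_funD.
apply: eq_measure_integral => [|? A mA _]; first exact: measurable_funD.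
exact: lebesgue_measure_shift.
Qed.

Lemma ge0_integral_reflect (c : R) (f : R -> \bar R) :
  measurable_fun setT f -> (forall x, 0 <= f x) ->
  \int[mu]_x f (c - x)%R = \int[mu]_x f x.
Proof.
move=> mf f0; rewrite -(ge0_integral_shift c mf f0).
have mg : measurable_fun setT (fun x : R => f (x + c)%R).
  by apply: measurableT_comp => //; exact: measurable_funD.
transitivity (\int[pushforward mu (-%R : _ -> measurableTypeR R)]_x f (x + c)%R).
  rewrite ge0_integral_pushforward//=.
  by apply: eq_integral => x _ /=; rewrite addrC.
by apply: eq_measure_integral => A mA _; exact: lebesgue_measureN.
Qed.

(** The rays []-oo, u]] are stable under intersection and generate the Borel sets, since []a, b]] is
    a difference of two of them. Finiteness of [m1] makes the rays []-oo, n]] an exhausting sequence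
    of finite measure. *)
Lemma measure_cdf_unique (m1 m2 : {measure set R -> \bar R}) :
  m1 setT < +oo -> (forall u : R, m1 `]-oo, u]%classic = m2 `]-oo, u]%classic) ->
  forall A, measurable A -> m1 A = m2 A.
Proof.
move=> fin12 m12 A mA.
pose G : set (set R) := [set A | exists u : R, A = `]-oo, u]%classic].
apply: (measure_unique G (fun n => `]-oo, n%:R]%classic)) => //.
- rewrite eqEsubset; split => [|X].
    rewrite /measurable/= -/(measurable) => X mX.
    have -> : <<s G >> X = (G.-sigma.-measurable) X by [].
    move: X mX; apply: smallest_sub; first exact: smallest_sigma_algebra.
    move=> _ [[a b] _ <-] /=.
    have -> : `]a, b]%classic = `]-oo, b] `\` `]-oo, a] :> set R.
      rewrite set_itvE; apply/seteqP; split=> x /=; rewrite !in_itv/=.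
        by move=> /andP[ax xb]; split => //; apply/negP; rewrite -ltNge.
      by move=> [xb /negP]; rewrite -ltNge => ->.
    by apply: measurableD; apply: sub_sigma_algebra; eexists.
  apply: smallest_sub; first exact: sigma_algebra_measurable.
  by move=> _ [u ->]; exact: measurable_itv.
- move=> _ _ [u ->] [v ->]; exists (Num.min u v).
  by apply/seteqP; split=> x /=; rewrite !in_itv/= le_min => /andP.
- by move=> n; exists n%:R.
- rewrite -subTset => x _; exists (Num.bound `|x|%R) => //=.
  by rewrite in_itv/= (le_trans (ler_norm _))// ltW// archi_boundP.
- by move=> _ [u ->].
- move=> n; apply: le_lt_trans fin12; apply: le_measure; rewrite ?inE//.
Qed.

End measure_tools.

Section density.
Context {R : realType} d (T : measurableType d).
Local Open Scope ereal_scope.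
Variables (m nu : {measure set T -> \bar R}) (g : T -> R).
Hypotheses (mg : measurable_fun setT g) (g0 : forall x, (0 <= g x)%R).
Hypothesis nuE : forall A, measurable A -> nu A = \int[m]_(x in A) (g x)%:E.
Import HBNNSimple.

Let integral_density_nnsfun (f : {nnsfun T >-> R}) :
  \int[nu]_x (f x)%:E = \int[m]_x ((f x)%:E * (g x)%:E).
Proof.
under eq_integral do rewrite fimfunE -fsumEFin//.
rewrite ge0_integral_fsum//; last 2 first.
  - by move=> r; exact/measurable_EFinP/measurableT_comp.
  - by move=> n x _; rewrite EFinM nnfun_muleindic_ge0.
under [RHS]eq_integral.
  move=> x _; rewrite fimfunE -fsumEFin// muleC ge0_mule_fsumr; last first.
    by move=> r; rewrite EFinM nnfun_muleindic_ge0.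
  over.
rewrite [RHS]ge0_integral_fsum//; last 2 first.
  - move=> r; apply: emeasurable_funM; first exact/measurable_EFinP.
    exact/measurable_EFinP/measurableT_comp.
  - move=> n x _; apply: mule_ge0; first by rewrite lee_fin.
    by rewrite EFinM nnfun_muleindic_ge0.
apply: eq_fsbigr => r /[!inE] rf.
have r0 : (0 <= r)%R by case: rf => x _ <-.
under [RHS]eq_integral do rewrite EFinM muleCA.
rewrite integralZl_indic_nnsfun// integral_indic// setIT nuE//.
rewrite integral_indicr ge0_integralZl//.
  apply: emeasurable_funM; first exact/measurable_EFinP.
  exact/measurable_EFinP/measurable_indic.
by move=> x _; rewrite mule_ge0// lee_fin.
Qed.

(** The identity for simple functions passes to the limit by monotone convergence on both sides. *)
Lemma ge0_integral_density (f : T -> \bar R) :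
  measurable_fun setT f -> (forall x, 0 <= f x) ->
  \int[nu]_x f x = \int[m]_x (f x * (g x)%:E).
Proof.
move=> mf f0; pose f_ := nnsfun_approx measurableT mf.
transitivity (limn (fun n => \int[nu]_x (f_ n x)%:E)).
  rewrite -monotone_convergence//=.
  - apply: eq_integral => x _; apply/esym/cvg_lim => //.
    exact: cvg_nnsfun_approx.
  - by move=> n; exact/measurable_EFinP/measurable_funTS.
  - by move=> n ? _; rewrite lee_fin.
  - by move=> ? _ ? ? mn; rewrite lee_fin; exact/lefP/nd_nnsfun_approx.
transitivity (limn (fun n => \int[m]_x ((f_ n x)%:E * (g x)%:E))).
  by apply: congr_lim; apply/funext => n; exact: integral_density_nnsfun.
rewrite -monotone_convergence//=.
- apply: eq_integral => x _; apply/cvg_lim => //.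
  by apply: cvgeZr => //; exact: cvg_nnsfun_approx.
- move=> n; apply: emeasurable_funM; last exact/measurable_EFinP.
  exact/measurable_EFinP/measurable_funTS.
- by move=> n x _; apply: mule_ge0; rewrite lee_fin.
- move=> ? _ ? ? mn; apply: lee_wpmul2r; rewrite ?lee_fin//.
  exact/lefP/nd_nnsfun_approx.
Qed.

End density.

Section tail_integral.
Context {R : realType}.
Local Open Scope ereal_scope.
Notation mu := (@lebesgue_measure R).

(* [lebesgue_measure] lives on [measurableTypeR R], whose display differs from
   that of [R]; the identity transports measures from one to the other. *)
Lemma ge0_integral_lebesgue_density (Q : probability R R) (g : R -> R)
    (f : R -> \bar R) :
  measurable_fun setT g -> (forall x, (0 <= g x)%R) ->
  (forall A, measurable A -> Q A = \int[mu]_(x in A) (g x)%:E) ->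
  measurable_fun setT f -> (forall x, 0 <= f x) ->
  \int[Q]_x f x = \int[mu]_x (f x * (g x)%:E).
Proof.
move=> mg g0 QE mf f0.
transitivity (\int[pushforward Q (fun x : R => x : measurableTypeR R)]_x f x).
  by rewrite ge0_integral_pushforward.
by apply: ge0_integral_density.
Qed.

(** A jointly measurable indicator of the region [0 <= s < y] turns an inner integral with variable
    upper end into one over the whole line, to which Tonelli applies. *)
Let mem_itv0 (p : R * measurableTypeR R) : R := \1_`[0%R, p.1[ p.2.

Let measurable_mem_itv0 : measurable_fun setT mem_itv0.
Proof.
have -> : mem_itv0 = \1_[set p : R * measurableTypeR R | (0 <= p.2 < p.1)%R].
  by apply/funext => p; rewrite /mem_itv0 !indicE; congr (_%:R); rewrite !inE.
apply: measurable_indic.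
have -> : [set p : R * measurableTypeR R | (0 <= p.2 < p.1)%R] =
    ((fun p : R * measurableTypeR R => (0 <= p.2)%R) @^-1` [set true]) `&`
    ((fun p : R * measurableTypeR R => (p.2 < p.1)%R) @^-1` [set true]).
  by apply/seteqP; split=> p /= => [/andP|[-> ->]].
by apply: measurableI; rewrite -[X in measurable X]setTI;
  [apply: measurable_fun_ler|apply: measurable_fun_ltr].
Qed.

Let integrand (h : R -> \bar R) (p : R * measurableTypeR R) :=
  h p.2 * (mem_itv0 p)%:E.

Let measurable_integrand h : measurable_fun setT h ->
  measurable_fun setT (integrand h).
Proof.
move=> mh; apply: emeasurable_funM; first exact: measurableT_comp.
exact/measurable_EFinP.
Qed.

Lemma measurable_integral_itv0 (h : R -> \bar R) :
  measurable_fun setT h -> (forall x, 0 <= h x) ->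
  measurable_fun setT (fun y : R => \int[mu]_(s in `[0%R, y[) h s).
Proof.
move=> mh h0; under eq_fun do rewrite integral_indicr.
apply: (@measurable_fun_fubini_tonelli_F _ _ _ _ _ mu (integrand h)).
  exact: measurable_integrand.
by move=> p; rewrite /integrand mule_ge0// lee_fin.
Qed.

(** Tonelli on the region [0 <= s < y]: for fixed [s >= 0] the admissible [y] form []s, +oo[], while
    a negative [s] contributes nothing. *)
Lemma integral_tail (Q : probability R R) (h : R -> \bar R) :
  measurable_fun setT h -> (forall x, 0 <= h x) ->
  \int[Q]_y \int[mu]_(s in `[0%R, y[) h s =
  \int[mu]_(s in `[0%R, +oo[) (h s * Q `]s, +oo[%classic).
Proof.
move=> mh h0.
transitivity (\int[Q]_y \int[mu]_s integrand h (y, s)).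
  by apply: eq_integral => y _; rewrite integral_indicr.
rewrite (fubini_tonelli (integrand h))//; last 2 first.
  exact: measurable_integrand.
  by move=> p; rewrite /integrand mule_ge0// lee_fin.
rewrite [RHS]integral_indicr.
apply: eq_integral => s _; rewrite /integrand/mem_itv0/=.
have [s0|s0] := leP 0%R s; last first.
  rewrite [RHS](_ : _ = 0); last first.
    by rewrite indicE memNset ?mule0//= in_itv/= leNgt s0.
  apply: integral0_eq => y _.
  by rewrite indicE memNset ?mule0//= in_itv/= leNgt s0.
rewrite [in RHS]indicE [in RHS]mem_set/= ?in_itv/= ?s0// mule1.
under eq_integral => y _.
  rewrite (_ : \1_`[0%R, y[ s = \1_`]s, +oo[ y); last first.
    by rewrite !indicE; congr (_%:R); rewrite !mem_setE !in_itv/= s0 andbT.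
  over.
rewrite ge0_integralZl//; first by rewrite integral_indic// setIT.
exact/measurable_EFinP/measurable_indic.
Qed.

End tail_integral.

(** * Exponential laws *)

Section exponential_law.
Context {R : realType} (lambda : R) (Q : probability R R).
Hypothesis lambda0 : 0 < lambda.
Hypothesis QE : forall A, measurable A -> Q A = exponential_prob lambda A.
Local Open Scope ereal_scope.
Notation mu := (@lebesgue_measure R).

Lemma exponential_itvNy0 : Q `]-oo, 0%R]%classic = 0.
Proof.
rewrite QE// /exponential_prob -integral_itv_bndo_bndc; last first.
  by apply/measurable_funTS/measurable_EFinP; exact: measurable_exponential_pdf.
by apply: integral0_eq => x /=; rewrite in_itv/= => /lt0_exponential_pdf ->.
Qed.

Lemma exponential_tail s :
  (0 <= s)%R -> Q `]s, +oo[%classic = (expR (- lambda * s))%:E.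
Proof.
rewrite -setCitvl le_eqVlt => /predU1P[<-|s0].
  by rewrite mulr0 expR0 probability_setC// exponential_itvNy0 sube0.
rewrite probability_setC// (@itv_bndbnd_setU _ _ _ (BLeft 0%R))//; last first.
  by rewrite bnd_simp ltW.
rewrite measureU//; last first.
  apply/seteqP; split=> x //= []; rewrite !in_itv/= => x0.
  by rewrite leNgt x0.
rewrite [X in _ - (X + _)](_ : _ = 0) ?add0e.
  have Q0s : Q `[0%R, s]%classic = 1 - (expR (- lambda * s))%:E.
    by rewrite QE// exponential_prob_itv0c.
  rewrite [X in 1 - X]Q0s.
  transitivity (1 - (1 - expR (- lambda * s)))%R%:E => //; congr EFin.
  by rewrite opprB addrC subrK.
apply/eqP; rewrite eq_le measure_ge0 andbT -exponential_itvNy0.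
by apply: le_measure; rewrite ?inE// => x/=; rewrite !in_itv/= => /ltW.
Qed.

(** By [integral_tail] the left side integrates [h] against the exponential tail, which is
    [lambda^-1] times the exponential density. *)
Lemma exponential_integral_primitive (h : R -> \bar R) :
  measurable_fun setT h -> (forall x, 0 <= h x) ->
  \int[Q]_t \int[mu]_(s in `[0%R, t[) h s = lambda^-1%:E * \int[Q]_t h t.
Proof.
move=> mh h0; rewrite integral_tail//.
rewrite (@ge0_integral_lebesgue_density _ Q (exponential_pdf lambda))//; last 2 first.
  exact: measurable_exponential_pdf.
  by move=> x; apply: exponential_pdf_ge0; exact: ltW.
rewrite -ge0_integralZl//; last 3 first.
- apply: emeasurable_funM => //; apply/measurable_EFinP.
  exact: measurable_exponential_pdf.
- by move=> x _; rewrite mule_ge0// lee_fin exponential_pdf_ge0// ltW.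
- by rewrite lee_fin invr_ge0 ltW.
rewrite [LHS]integral_indicr; apply: eq_integral => s _.
rewrite muleCA -muleA; congr (_ * _).
have [s0|s0] := leP 0%R s.
  rewrite exponential_tail// indicE mem_set/= ?in_itv/= ?s0//.
  by rewrite exponential_pdfE// -!EFinM mulr1 mulKf// gt_eqF.
rewrite lt0_exponential_pdf// mule0 indicE memNset ?mule0//=.
by rewrite in_itv/= leNgt s0.
Qed.

End exponential_law.


(** * Convolution and integrated tails *)

Section convolution.
Context {R : realType}.
Local Open Scope ereal_scope.
Notation mu := (@lebesgue_measure R).
Implicit Types (Q : probability R R) (f : R -> \bar R).

Definition conv Q f (u : R) : \bar R := \int[Q]_y f (u - y)%R.

Lemma conv_ge0 Q f u : (forall x, 0 <= f x) -> 0 <= conv Q f u.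
Proof. by move=> f0; exact: integral_ge0. Qed.

Lemma measurable_conv Q f : measurable_fun setT f -> (forall x, 0 <= f x) ->
  measurable_fun setT (conv Q f).
Proof.
move=> mf f0.
apply: (@measurable_fun_fubini_tonelli_F _ _ _ _ _ Q
  (fun p : R * R => f (p.1 - p.2)%R)) => //.
by apply: measurableT_comp => //; exact: measurable_funB.
Qed.

Lemma ge0_integral_support Q (h : R -> \bar R) :
  Q `]-oo, 0%R[%classic = 0 ->
  measurable_fun setT h -> (forall x, 0 <= h x) ->
  \int[Q]_x h x = \int[Q]_(x in `[0%R, +oo[) h x.
Proof.
move=> Q0 mh h0; rewrite (@ge0_negligible_integral _ _ _ Q setT `]-oo, 0%R[)//.
by rewrite setTD setCitvl.
Qed.

(** This allows a deterministic term to be absorbed into a [Q]-integral over the half-line, so that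
    an identity between sums can be checked pointwise for [y >= 0]. *)
Lemma integral_nneg_cst Q (c : \bar R) :
  Q `]-oo, 0%R[%classic = 0 -> 0 <= c ->
  \int[Q]_(x in `[0%R, +oo[) c = c.
Proof.
move=> Q0 c0; rewrite -ge0_integral_support//.
by rewrite integral_cst//= probability_setT mule1.
Qed.

Lemma measurable_indic_itv (D : set R) (g : R -> R) :
  measurable D -> measurable_fun setT g ->
  measurable_fun setT (fun x => (\1_D (g x))%:E : \bar R).
Proof.
move=> mD mg; apply/measurable_EFinP.
by apply: (measurableT_comp (f := (\1_D : R -> R))) => //; exact: measurable_indic.
Qed.

Let restrictE (F : R * measurableTypeR R -> \bar R) (D : set R) :=
  fun p => F p * (\1_D p.2)%:E.

Let measurable_restrictE F D : measurable_fun setT F -> measurable D ->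
  measurable_fun setT (restrictE F D).
Proof.
move=> mF mD; apply: emeasurable_funM => //; apply/measurable_EFinP.
by apply: (measurableT_comp (f := (\1_D : R -> R))) => //; exact: measurable_indic.
Qed.

Lemma measurable_integral_param (F : R * measurableTypeR R -> \bar R)
    (D : set R) :
  measurable_fun setT F -> (forall p, 0 <= F p) -> measurable D ->
  measurable_fun setT (fun y : R => \int[mu]_(s in D) F (y, s)).
Proof.
move=> mF F0 mD; under eq_fun do rewrite integral_indicr.
apply: (@measurable_fun_fubini_tonelli_F _ _ _ _ _ mu (restrictE F D)).
  exact: measurable_restrictE.
by move=> p; rewrite /restrictE mule_ge0// lee_fin.
Qed.

Lemma exchange_integral_in Q (F : R * measurableTypeR R -> \bar R)
    (D : set R) :
  measurable_fun setT F -> (forall p, 0 <= F p) -> measurable D ->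
  \int[Q]_y \int[mu]_(s in D) F (y, s) = \int[mu]_(s in D) \int[Q]_y F (y, s).
Proof.
move=> mF F0 mD.
transitivity (\int[Q]_y \int[mu]_s restrictE F D (y, s)).
  by apply: eq_integral => y _; rewrite integral_indicr.
rewrite (fubini_tonelli (restrictE F D))//; last 2 first.
  exact: measurable_restrictE.
  by move=> p; rewrite /restrictE mule_ge0// lee_fin.
rewrite [RHS]integral_indicr; apply: eq_integral => s _.
rewrite /restrictE/= ge0_integralZr//.
exact: measurableT_comp.
Qed.

(* The integral of f over [0, u] is split at the random point u - y, y ~ Q. *)
Lemma integral_conv_tail Q f (u : R) :
  Q `]-oo, 0%R[%classic = 0 -> measurable_fun setT f -> (forall x, 0 <= f x) ->
  (forall x, (x < 0)%R -> f x = 0) ->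
  \int[mu]_(s in `[0%R, u]) conv Q f s +
  \int[mu]_(x in `[0%R, +oo[) (f (u - x)%R * Q `]x, +oo[%classic) =
  \int[mu]_(s in `[0%R, u]) f s.
Proof.
move=> Q0 mf f0 fneg.
have mfu : measurable_fun setT (fun x : R => f (u - x)%R).
  by apply: measurableT_comp => //; exact: measurable_funB.
pose F (p : R * measurableTypeR R) := f (p.2 - p.1)%R.
have mF : measurable_fun setT F.
  by apply: measurableT_comp => //; exact: measurable_funB.
have mI : measurable_fun setT (fun y : R => \int[mu]_(s in `[0%R, u]) f (s - y)%R).
  by apply: (measurable_integral_param mF) => [p|]; rewrite ?/F.
have -> : \int[mu]_(s in `[0%R, u]) conv Q f s =
    \int[Q]_y \int[mu]_(s in `[0%R, u]) f (s - y)%R.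
  by rewrite (exchange_integral_in Q mF)// => p; rewrite /F.
have -> : \int[mu]_(x in `[0%R, +oo[) (f (u - x)%R * Q `]x, +oo[%classic) =
    \int[Q]_y \int[mu]_(s in `[0%R, y[) f (u - s)%R.
  by rewrite -(integral_tail Q mfu (fun x => f0 _)).
rewrite -ge0_integralD//; last 3 first.
- by move=> y _; exact: integral_ge0.
- by move=> y _; exact: integral_ge0.
- exact: measurable_integral_itv0.
rewrite ge0_integral_support//; last 2 first.
- by apply: emeasurable_funD => //; exact: measurable_integral_itv0.
- by move=> y; rewrite adde_ge0//; exact: integral_ge0.
rewrite -[RHS](@integral_nneg_cst Q)//; last exact: integral_ge0.
apply: eq_integral => y; rewrite inE/= in_itv/= andbT => y0.
rewrite [X in X + _]integral_indicr [X in _ + X]integral_indicr [RHS]integral_indicr.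
(* The substitutions [x = s - y] in the first integral and [x = u - s] in the second make both of
   them integrals of the same [f x]. *)
transitivity (\int[mu]_x (f x * (\1_`[0%R, u] (x + y)%R)%:E)
   + \int[mu]_x (f x * (\1_`[0%R, y[ (u - x)%R)%:E)).
  congr (_ + _).
    rewrite -[LHS](@ge0_integral_shift _ y).
    + by apply: eq_integral => x _; rewrite addrK.
    + apply: emeasurable_funM; last exact: measurable_indic_itv.
      by apply: measurableT_comp => //; exact: measurable_funB.
    + by move=> x; rewrite mule_ge0// lee_fin.
  rewrite -[RHS](@ge0_integral_reflect _ u).
  + by apply: eq_integral => x _; rewrite subKr.
  + apply: emeasurable_funM => //; apply: measurable_indic_itv => //.
    exact: measurable_funB.
  + by move=> x; rewrite mule_ge0// lee_fin.
rewrite -ge0_integralD//; last 4 first.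
- by move=> x _; rewrite mule_ge0// lee_fin.
- apply: emeasurable_funM => //; apply: measurable_indic_itv => //.
  exact: measurable_funD.
- by move=> x _; rewrite mule_ge0// lee_fin.
- apply: emeasurable_funM => //; apply: measurable_indic_itv => //.
  exact: measurable_funB.
apply: eq_integral => x _.
(* For [x >= 0] the conditions [x <= u - y] and [u - y < x <= u] partition [x <= u]; for [x < 0] the
   factor [f x] vanishes. *)
have [x0|x0] := ltP x 0%R; first by rewrite fneg// !mul0e add0e.
rewrite -ge0_muleDr ?lee_fin//; congr (_ * _).
rewrite -EFinD; congr EFin.
rewrite !indicE !mem_setE !in_itv/= x0 addr_ge0//= subr_ge0.
rewrite -lerBrDr ltrBlDr -ltrBlDl.
case: (leP x (u - y)%R) => xuy /=.
  by rewrite andbF addr0 (le_trans xuy)// gerBl.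
by rewrite andbT add0r.
Qed.

Lemma integral_itv_shift f (a b : R) :
  measurable_fun setT f -> (forall x, 0 <= f x) -> (0 <= a)%R -> (0 <= b)%R ->
  \int[mu]_(s in `[0%R, a[) f s + \int[mu]_(s in `[0%R, b[) f (s + a)%R =
  \int[mu]_(s in `[0%R, (a + b)%R[) f s.
Proof.
move=> mf f0 a0 b0.
rewrite [X in X + _]integral_indicr [X in _ + X]integral_indicr [RHS]integral_indicr.
have mI : measurable_fun setT (fun x : R => (\1_`[0%R, b[ (x - a)%R)%:E : \bar R).
  by apply: measurable_indic_itv => //; exact: measurable_funB.
have -> : \int[mu]_x (f (x + a)%R * (\1_`[0%R, b[ x)%:E) =
    \int[mu]_x (f x * (\1_`[0%R, b[ (x - a)%R)%:E).
  rewrite -[RHS](@ge0_integral_shift _ a).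
  + by apply: eq_integral => x _; rewrite addrK.
  + exact: emeasurable_funM.
  + by move=> x; rewrite mule_ge0// lee_fin.
rewrite -ge0_integralD//; last 4 first.
- by move=> x _; rewrite mule_ge0// lee_fin.
- by apply: emeasurable_funM => //; apply/measurable_EFinP/measurable_indic.
- by move=> x _; rewrite mule_ge0// lee_fin.
- exact: emeasurable_funM.
apply: eq_integral => x _.
rewrite -ge0_muleDr ?lee_fin//; congr (_ * _).
rewrite -EFinD; congr EFin.
rewrite !indicE !mem_setE !in_itv/= subr_ge0 ltrBlDl.
case: (leP a x) => ax; last by rewrite addr0 (lt_le_trans ax) // lerDl.
by rewrite andbF add0r (le_trans a0 ax).
Qed.

(** Both sides are the mean over [t] of the integral of [f] over [[0, u + t[], split at [u] on the
    left and at [t] on the right. [exponential_integral_primitive] evaluates the pieces whose length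
    is [t]. *)
Lemma integral_exponential_shift (lambda : R) Q f (u : R) :
  (0 < lambda)%R ->
  (forall A, measurable A -> Q A = exponential_prob lambda A) ->
  measurable_fun setT f -> (forall x, 0 <= f x) -> (0 <= u)%R ->
  \int[mu]_(s in `[0%R, u[) f s + lambda^-1%:E * \int[Q]_t f (t + u)%R =
  lambda^-1%:E * \int[Q]_t f t +
    \int[mu]_(s in `[0%R, u[) \int[Q]_t f (s + t)%R.
Proof.
move=> lambda0 QE mf f0 u0.
have Q0 : Q `]-oo, 0%R[%classic = 0.
  apply/eqP; rewrite eq_le measure_ge0 andbT -(exponential_itvNy0 QE).
  by apply: le_measure; rewrite ?inE// => x/=; rewrite !in_itv/= => /ltW.
have mfu : measurable_fun setT (fun x : R => f (x + u)%R).
  by apply: measurableT_comp => //; exact: measurable_funD.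
pose F (p : R * measurableTypeR R) := f (p.2 + p.1)%R.
have mF : measurable_fun setT F.
  by apply: measurableT_comp => //; exact: measurable_funD.
have mI : measurable_fun setT (fun y : R => \int[mu]_(s in `[0%R, u[) f (s + y)%R).
  by apply: (measurable_integral_param mF) => [p|]; rewrite ?/F.
have -> : \int[mu]_(s in `[0%R, u[) \int[Q]_t f (s + t)%R =
    \int[Q]_t \int[mu]_(s in `[0%R, u[) f (s + t)%R.
  by rewrite (exchange_integral_in Q mF)// => p; rewrite /F.
rewrite -(exponential_integral_primitive lambda0 QE mf f0).
rewrite -(exponential_integral_primitive lambda0 QE mfu (fun x => f0 _)).
have i0 : 0 <= \int[mu]_(s in `[0%R, u[) f s by exact: integral_ge0.
rewrite -[in LHS](integral_nneg_cst Q0 i0).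
have mp := measurable_integral_itv0 mf f0.
have mpu := measurable_integral_itv0 mfu (fun x => f0 _).
rewrite -[RHS]ge0_integralD//; last 2 first.
- by move=> y _; exact: integral_ge0.
- by move=> y _; exact: integral_ge0.
rewrite [X in _ + X]ge0_integral_support//; last by move=> y; exact: integral_ge0.
rewrite [RHS]ge0_integral_support//; last 2 first.
- exact: emeasurable_funD.
- by move=> y; rewrite adde_ge0//; exact: integral_ge0.
rewrite -[LHS]ge0_integralD//; last 2 first.
- by move=> y _; exact: integral_ge0.
- exact: measurable_funTS.
apply: eq_integral => t; rewrite inE/= in_itv/= andbT => t0.
by rewrite !integral_itv_shift// addrC.
Qed.

End convolution.

Section integrated_tail.
Context {R : realType}.
Local Open Scope ereal_scope.
Notation mu := (@lebesgue_measure R).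
Variables (lambda : R) (E F : probability R R) (f g : R -> \bar R).
Hypothesis lambda0 : (0 < lambda)%R.
Hypothesis EE : forall A, measurable A -> E A = exponential_prob lambda A.
Hypothesis F0 : F `]-oo, 0%R[%classic = 0.
Hypotheses (mf : measurable_fun setT f) (mg : measurable_fun setT g).
Hypotheses (f0 : forall x, 0 <= f x) (g0 : forall x, 0 <= g x).
Hypothesis f1 : forall x, f x <= 1.
Hypothesis fneg : forall x : R, (x < 0)%R -> f x = 0.
Hypothesis gE : forall u : R, (0 <= u)%R ->
  g u = \int[E]_t conv F f (u + t)%R.

(** The convolution of [f] with the unnormalised ladder-height kernel, whose density is [lambda]
    times the tail of [F]. *)
Definition tail_conv (u : R) : \bar R :=
  lambda%:E * \int[mu]_(x in `[0%R, +oo[) (f (u - x)%R * F `]x, +oo[%classic).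

Let mk := measurable_conv F mf f0.
Let k0 u := conv_ge0 F u f0.

Let mEk : measurable_fun setT (fun s : R => \int[E]_t conv F f (s + t)%R).
Proof.
apply: (@measurable_fun_fubini_tonelli_F _ _ _ _ _ E
  (fun p : R * R => conv F f (p.1 + p.2)%R)) => //.
by apply: measurableT_comp => //; exact: measurable_funD.
Qed.

(** With [k = conv F f], this is the integrated form of [g' = lambda (g - k)]; working with
    integrals avoids any differentiability question. *)
Let integral_g u : (0 <= u)%R ->
  \int[mu]_(s in `[0%R, u]) conv F f s + lambda^-1%:E * g u =
  lambda^-1%:E * g 0%R + \int[mu]_(s in `[0%R, u]) g s.
Proof.
move=> u0; have := integral_exponential_shift lambda0 EE mk k0 u0.
rewrite !integral_itv_bndo_bndc; [|exact: measurable_funTS..].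
under [X in _ + _ * X = _]eq_integral do rewrite addrC.
rewrite -gE// => ->; congr (_ * _ + _).
  by rewrite gE//; apply: eq_integral => t _; rewrite add0r.
by apply: eq_integral => s; rewrite inE/= in_itv/= => /andP[s0 _]; rewrite gE.
Qed.

(** Finiteness licenses the cancellation of this integral in extended real arithmetic. *)
Let integral_k_fin u : (0 <= u)%R ->
  \int[mu]_(s in `[0%R, u]) conv F f s \is a fin_num.
Proof.
move=> u0; rewrite ge0_fin_numE; last exact: integral_ge0.
apply: (@le_lt_trans _ _ (\int[mu]_(s in `[0%R, u]) 1)).
  apply: ge0_le_integral => //; first exact: measurable_funTS.
  move=> x _; rewrite /conv.
  apply: (@le_trans _ _ (\int[F]_x 1)).
    apply: ge0_le_integral => //.
    by apply: measurableT_comp => //; exact: measurable_funB.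
  by rewrite integral_cst//= probability_setT mule1.
rewrite integral_cst//= lebesgue_measure_itv/= mul1e lte_fin.
by case: ifP; rewrite ?oppr0 ?adde0 ?ltry.
Qed.

(** [integral_g] and [integral_conv_tail] share the integral of [conv F f]. After its cancellation
    the claim reduces to comparing the integrals of [g] and [f] over [[0, u]]. It serves consecutive
    finite horizons, with [g] the longer one. *)
Lemma le_tail_conv u : (0 <= u)%R -> (forall v, (0 <= v)%R -> g v <= f v) ->
  g u <= g 0%R + tail_conv u.
Proof.
move=> u0 gf; have kfin := integral_k_fin u0.
rewrite -(@lee_pmul2l _ lambda^-1%:E)// ?lte_fin ?invr_gt0//.
rewrite ge0_muleDr//; last by apply: mule_ge0; [rewrite lee_fin ltW|
  apply: integral_ge0 => x _; exact: mule_ge0].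
rewrite /tail_conv muleA -EFinM mulVf ?gt_eqF// mul1e.
rewrite -(leeD2lE _ _ kfin) addeCA.
rewrite integral_conv_tail// integral_g//; apply: leeD2l.
apply: ge0_le_integral => //; [exact: measurable_funTS|exact: measurable_funTS|].
by move=> x /=; rewrite in_itv/= => /andP[x0 _]; exact: gf.
Qed.

(** The same cancellation at a fixed point, where the integrals of [g] and [f] coincide. *)
Lemma tail_convE u : (0 <= u)%R -> (forall v, (0 <= v)%R -> g v = f v) ->
  g u = g 0%R + tail_conv u.
Proof.
move=> u0 gf; have kfin := integral_k_fin u0.
have := integral_g u0.
have -> : \int[mu]_(s in `[0%R, u]) g s = \int[mu]_(s in `[0%R, u]) f s.
  by apply: eq_integral => s; rewrite inE/= in_itv/= => /andP[s0 _]; rewrite gf.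
rewrite -(integral_conv_tail u F0 mf f0 fneg) addeCA.
rewrite [X in X = _ -> _]addeC [X in _ = X -> _]addeC.
move=> /(congr1 (fun x => x - \int[mu]_(s in `[0%R, u]) conv F f s)).
rewrite !addeK//.
move/(congr1 (fun x => lambda%:E * x)).
rewrite ge0_muleDr; last 2 first.
- by apply: mule_ge0 => //; rewrite lee_fin invr_ge0 ltW.
- by apply: integral_ge0 => x _; exact: mule_ge0.
by rewrite !muleA -EFinM mulfV ?gt_eqF// !mul1e.
Qed.

End integrated_tail.


(** * Stationary excess laws *)

Section cdf_density.
Context {R : realType} (g : R -> R).
Hypotheses (mg : measurable_fun setT g) (g0 : forall x, 0 <= g x).
Local Open Scope ereal_scope.

(** The set function with density [g] is made a measure so that [measure_cdf_unique] can identify it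
    with [Q]. *)
Let nu (A : set R) := \int[lebesgue_measure]_(x in A) (g x)%:E.

Let nu0 : nu set0 = 0.
Proof. exact: integral_set0. Qed.

Let nu_ge0 A : 0 <= nu A.
Proof. by apply: integral_ge0 => x _; rewrite lee_fin. Qed.

Let nu_sigma_additive : semi_sigma_additive nu.
Proof.
move=> A mA tA mUA; rewrite /nu; apply: cvg_toP.
  apply: ereal_nondecreasing_is_cvgn => m n mn.
  apply: lee_sum_nneg_natr => // k _ _; apply: integral_ge0 => x _.
  by rewrite lee_fin.
rewrite ge0_integral_bigcup//=.
  exact/measurable_funTS/measurable_EFinP.
by move=> x _; rewrite lee_fin.
Qed.

HB.instance Definition _ := isMeasure.Build _ _ _ nu
  nu0 nu_ge0 nu_sigma_additive.

Lemma integral_cdf_density (Q : probability R R) (f : R -> \bar R) :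
  (forall u : R, Q `]-oo, u]%classic =
     \int[lebesgue_measure]_(x in `]-oo, u]) (g x)%:E) ->
  measurable_fun setT f -> (forall x, 0 <= f x) ->
  \int[Q]_x f x = \int[lebesgue_measure]_x (f x * (g x)%:E).
Proof.
move=> Qg mf f0; apply: ge0_integral_lebesgue_density => // A mA.
apply: (@measure_cdf_unique R Q nu) => //.
by rewrite [ltLHS]probability_setT ltry.
Qed.

End cdf_density.

Section excess.
Context d (T : measurableType d) (R : realType) (P : probability T R).
Local Open Scope ereal_scope.
Notation mu := (@lebesgue_measure R).
Variables X Y : {RV P >-> R}.
Hypothesis XY : has_excess_law P X Y.

Let c := ((fine 'E_P[X])^-1)%R.

(** The excess law is prescribed only at [u >= 0]; its value at 0, an integral over one point,
    already excludes mass on the negative half-line. *)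
Lemma excess_itvNy0 : cdf Y 0%R = 0.
Proof. by rewrite XY// set_itv1 integral_set1 mule0. Qed.

Lemma excess_itvNy0o : distribution P Y `]-oo, 0%R[%classic = 0.
Proof.
apply/eqP; rewrite eq_le measure_ge0 andbT -excess_itvNy0.
by apply: le_measure; rewrite ?inE// => x/=; rewrite !in_itv/= => /ltW.
Qed.

Hypothesis EX0 : (0 <= fine 'E_P[X])%R.

(** Comparison of distribution functions shows that [Y] has the density [g], equal to the tail of
    [X] over its mean on the half-line and to zero elsewhere. *)
Lemma integral_excess (f : R -> \bar R) :
  measurable_fun setT f -> (forall x, 0 <= f x) ->
  \int[distribution P Y]_x f x =
  c%:E * \int[mu]_(x in `[0%R, +oo[) (f x * ccdf X x).
Proof.
move=> mf f0.
pose g x := (c * fine (ccdf X x) * \1_`[0%R, +oo[ x)%R.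
have c0 : (0 <= c)%R by rewrite invr_ge0.
have fin x : ccdf X x \is a fin_num by rewrite fin_num_measure.
have g0 x : (0 <= g x)%R by rewrite !mulr_ge0// fine_ge0.
have mc : measurable_fun setT (fun x => fine (ccdf X x)).
  apply: (measurableT_comp (f := fine)) => //; exact: ccdf_measurable.
have mg : measurable_fun setT g.
  by apply: measurable_funM; [exact: measurable_funM|exact: measurable_indic].
rewrite (integral_cdf_density mg g0)//; last first.
  move=> u; have [u0|u0] := ltP u 0%R.
    rewrite [RHS]integral0_eq; last first.
      move=> x /=; rewrite in_itv/= => xu.
      by rewrite /g indicE memNset ?mulr0//= in_itv/= leNgt (le_lt_trans xu u0).
    apply/eqP; rewrite eq_le measure_ge0 andbT -excess_itvNy0.
    by apply: cdf_nondecreasing; exact: ltW.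
  transitivity (cdf Y u); first by [].
  rewrite XY// -/c.
  rewrite [X in _ * X]integral_indicr [RHS]integral_indicr -ge0_integralZl//.
  - apply: eq_integral => x _.
    rewrite -ccdf_1_cdf /g -[in LHS](fineK (fin x)) -!EFinM -!mulrA.
    congr ((_ * (_ * _))%:E); rewrite !indicE -natrM mulnb; congr (_%:R).
    by rewrite !mem_setE !in_itv/= andbT.
  - apply: emeasurable_funM; last exact/measurable_EFinP/measurable_indic.
    by under eq_fun do rewrite -ccdf_1_cdf; exact: ccdf_measurable.
  - by move=> x _; rewrite mule_ge0// ?lee_fin// -ccdf_1_cdf.
rewrite [X in _ * X]integral_indicr -ge0_integralZl//; last 2 first.
- apply: emeasurable_funM; last exact/measurable_EFinP/measurable_indic.
  by apply: emeasurable_funM => //; exact: ccdf_measurable.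
- by move=> x _; rewrite !mule_ge0// lee_fin.
apply: eq_integral => x _.
by rewrite /g !EFinM fineK// -!muleA [LHS]muleCA.
Qed.

End excess.


(** * Independence *)

Section independent_pair.
Context d (T : measurableType d) (R : realType) (P : probability T R).
Local Open Scope ereal_scope.

(** The joint law agrees with the product measure on rectangles, hence everywhere. *)
Lemma independent_pairE (X Y : {RV P >-> R}) :
  (forall A B, measurable A -> measurable B ->
     P (X @^-1` A `&` Y @^-1` B) = P (X @^-1` A) * P (Y @^-1` B)) ->
  forall A : set (R * R), measurable A ->
  P [set w | A (X w, Y w)] =
  \int[distribution P X]_x distribution P Y (xsection A x).
Proof.
move=> XY A mA.
have mXY : measurable_fun setT (fun w => (X w, Y w)) by exact: measurable_fun_pair.
rewrite -[RHS]/((distribution P X \x distribution P Y) A).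
apply/esym; apply: (@product_measure_unique _ _ _ _ _
  (distribution P X) (distribution P Y)
  (pushforward P (fun w => (X w, Y w)))) => //.
Qed.

Lemma cdf_independent_sum (X Y : {RV P >-> R}) (u : R) :
  (forall A B, measurable A -> measurable B ->
     P (X @^-1` A `&` Y @^-1` B) = P (X @^-1` A) * P (Y @^-1` B)) ->
  P [set w | (X w + Y w <= u)%R] = conv (distribution P X) (cdf Y) u.
Proof.
move=> XY; pose A := [set p : R * R | (p.1 + p.2 <= u)%R].
have mA : measurable A.
  have -> : A = (fun p : R * R => (p.1 + p.2 <= u)%R) @^-1` [set true].
    by apply/seteqP; split => p.
  rewrite -[X in measurable X]setTI; apply: measurable_fun_ler => //.
  exact: measurable_funD.
rewrite -[LHS]/(P [set w | A (X w, Y w)]) independent_pairE//.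
apply: eq_integral => x _; rewrite /cdf; congr (distribution P Y _).
by apply/seteqP; split=> y; rewrite /xsection/= in_itv/= inE/= lerBrDl.
Qed.

Lemma cdf_independent_diff (X Y : {RV P >-> R}) (u : R) :
  (forall A B, measurable A -> measurable B ->
     P (X @^-1` A `&` Y @^-1` B) = P (X @^-1` A) * P (Y @^-1` B)) ->
  P [set w | (Y w - X w <= u)%R] = \int[distribution P X]_x cdf Y (u + x)%R.
Proof.
move=> XY; pose A := [set p : R * R | (p.2 - p.1 <= u)%R].
have mA : measurable A.
  have -> : A = (fun p : R * R => (p.2 - p.1 <= u)%R) @^-1` [set true].
    by apply/seteqP; split => p.
  rewrite -[X in measurable X]setTI; apply: measurable_fun_ler => //.
  exact: measurable_funB.
rewrite -[LHS]/(P [set w | A (X w, Y w)]) independent_pairE//.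
apply: eq_integral => x _; rewrite /cdf; congr (distribution P Y _).
by apply/seteqP; split=> y; rewrite /xsection/= in_itv/= inE/= -lerBlDr.
Qed.

End independent_pair.

Section grouping.
Context d (T : measurableType d) (R : realType) (P : probability T R).
Local Open Scope ereal_scope.

(** For fixed [B], both sides are finite measures in [A] that agree on the intersection-stable
    system [G]. *)
Lemma independent_g_sigma_algebra (G : set (set T)) (B : set T) :
  G `<=` measurable -> setI_closed G -> G setT -> measurable B ->
  (forall A, G A -> P (A `&` B) = P A * P B) ->
  forall A, <<s G >> A -> P (A `&` B) = P A * P B.
Proof.
move=> Gm GI GT mB GB A GA.
have PBE : P B = (fine (P B))%:E by rewrite fineK// fin_num_measure.
have PB0 : (0 <= fine (P B))%R by rewrite fine_ge0.
rewrite [RHS]muleC PBE.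
apply: (@g_sigma_algebra_measure_unique _ _ _ G Gm (fun=> setT) _ _
  (mrestr P mB) (mscale (NngNum PB0) P)) => //.
- by rewrite bigcup_const.
- by move=> C GC /=; rewrite /mrestr /mscale/= -PBE muleC; exact: GB.
- by move=> _ /=; rewrite /mrestr setTI ltey_eq fin_num_measure.
Qed.

Variables (I : eqType) (X : I -> {RV P >-> R}).
Hypothesis indX : mutually_independent P X.

(** Events constraining finitely many coordinates in [D]: an intersection-stable system that
    generates [sigma_of D] and contains [setT] through the empty list. *)
Let cylinder (D : set I) : set (set T) := [set C |
  exists J : seq I, exists A : I -> set R, [/\ uniq J, [set` J] `<=` D,
    forall i, measurable (A i) & C = \bigcap_(i in [set` J]) (X i @^-1` A i)] ].

Let cylinder_measurable D : cylinder D `<=` measurable.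
Proof.
move=> _ [J [A [_ _ mA ->]]]; apply: fin_bigcap_measurable => // i _.
by rewrite -[_ @^-1` _]setTI; exact: measurable_funP.
Qed.

Let cylinderT D : cylinder D setT.
Proof.
by exists [::], (fun=> setT); split => //; rewrite set_nil bigcap_set0.
Qed.

Let cylinderI D : setI_closed (cylinder D).
Proof.
move=> _ _ [J1 [A1 [_ JD1 mA1 ->]]] [J2 [A2 [_ JD2 mA2 ->]]].
(* A coordinate absent from one of the lists is left unconstrained by that factor. *)
exists (undup (J1 ++ J2)), (fun i => (if i \in J1 then A1 i else setT) `&`
                                     (if i \in J2 then A2 i else setT)).
split; first exact: undup_uniq.
- move=> i /=; rewrite mem_undup mem_cat => /orP[iJ|iJ]; [exact: JD1|exact: JD2].
- by move=> i; apply: measurableI; case: ifP.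
- apply/seteqP; split=> [w [w1 w2] i _|w w12]; split.
  + by case: ifPn => // iJ; exact: w1.
  + by case: ifPn => // iJ; exact: w2.
  + move=> i /= iJ; have [] := w12 i.
      by rewrite /= mem_undup mem_cat iJ.
    by rewrite iJ.
  + move=> i /= iJ; have [] := w12 i.
      by rewrite /= mem_undup mem_cat iJ orbT.
    by rewrite iJ.
Qed.

Let cylinder_independent D1 D2 A B : D1 `&` D2 = set0 ->
  cylinder D1 A -> cylinder D2 B -> P (A `&` B) = P A * P B.
Proof.
move=> D12 [J1 [A1 [uJ1 JD1 mA1 ->]]] [J2 [A2 [uJ2 JD2 mA2 ->]]].
have J12 i : i \in J2 -> i \notin J1.
  move=> i2; apply/negP => i1.
  have : (D1 `&` D2) i by split; [exact: JD1|exact: JD2].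
  by rewrite D12.
(* One family of sets serves both lists, as they are disjoint; mutual independence can then be
   applied to [J1], [J2] and [J1 ++ J2]. *)
pose A0 i := if i \in J1 then A1 i else A2 i.
have A1E i : i \in J1 -> A0 i = A1 i by rewrite /A0 => ->.
have A2E i : i \in J2 -> A0 i = A2 i by move=> /J12; rewrite /A0 => /negbTE ->.
rewrite [X in P (X `&` _)](_ : _ =
    \bigcap_(i in [set` J1]) (X i @^-1` A0 i)); last first.
  by apply: eq_bigcapr => i iJ; rewrite A1E.
rewrite [X in P (_ `&` X)](_ : _ =
    \bigcap_(i in [set` J2]) (X i @^-1` A0 i)); last first.
  by apply: eq_bigcapr => i iJ; rewrite A2E.
have mA i : measurable (A0 i) by rewrite /A0; case: ifP.
have set_cat : [set` J1] `|` [set` J2] = [set` J1 ++ J2].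
  by apply/seteqP; split=> i /=; rewrite mem_cat => /orP.
rewrite -bigcap_setU set_cat !indX//.
  rewrite big_cat/=; congr (_ * _); rewrite big_seq [RHS]big_seq;
    apply: eq_bigr => i iJ; by [rewrite A1E|rewrite A2E].
rewrite cat_uniq uJ1 uJ2 andbT/=; apply/hasPn => i; exact: J12.
Qed.

Let sigma_of_cylinder D :
  sigma_of D (fun i => X i : T -> R) `<=` <<s cylinder D >>.
Proof.
apply: smallest_sub; first exact: smallest_sigma_algebra.
move=> C [i Di [A mA <-]]; apply: sub_sigma_algebra.
exists [:: i], (fun=> A); split => //.
  by move=> j /=; rewrite inE => /eqP ->.
by rewrite set_cons1 bigcap_set1 setTI.
Qed.

(** Independence of cylinders is extended one side at a time: first over [A] with [B] fixed, then
    over [B] with a cylinder [A] fixed. *)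
Lemma independent_sigma_of (D1 D2 : set I) : D1 `&` D2 = set0 ->
  independent_systems P (sigma_of D1 (fun i => X i : T -> R))
                        (sigma_of D2 (fun i => X i : T -> R)).
Proof.
move=> D12 A B /sigma_of_cylinder sA /sigma_of_cylinder sB.
have mB : measurable B.
  apply: (smallest_sub (@sigma_algebra_measurable _ T) _ sB).
  exact: cylinder_measurable.
apply: (independent_g_sigma_algebra (@cylinder_measurable D1)
  (@cylinderI D1)) => //.
move=> {sA}A cA; rewrite setIC muleC.
apply: (independent_g_sigma_algebra (@cylinder_measurable D2)
  (@cylinderI D2)) => //.
  exact: cylinder_measurable cA.
move=> C cC; rewrite setIC muleC; exact: cylinder_independent cA cC.
Qed.

End grouping.

Section sigma_of.
Context d (T : measurableType d) d' (T' : measurableType d') (I : Type).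
Variables (D : set I) (X : I -> T -> T').

(** [T] equipped with the generated sigma-algebra, so that closure of measurable functions under
    sums and maxima applies to that smaller sigma-algebra. *)
Definition sigma_of_type : measurableType _ :=
  g_sigma_algebraType
    (\bigcup_(i in D) preimage_set_system setT (X i) measurable).

Lemma measurable_sigma_of i : D i ->
  measurable_fun (setT : set sigma_of_type) (X i).
Proof.
by move=> Di _ A mA; apply: sub_sigma_algebra; exists i => //; exists A.
Qed.

Lemma sigma_of_preimage d2 (T2 : measurableType d2) (f : T -> T2) (A : set T2) :
  measurable_fun (setT : set sigma_of_type) f -> measurable A ->
  sigma_of D X (f @^-1` A).
Proof. by move=> mf mA; rewrite -[_ @^-1` _]setTI; exact: mf. Qed.

End sigma_of.


(** * The renewal equation *)

Section bounded_convergence.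
Context {R : realType} d (T : measurableType d).
Local Open Scope ereal_scope.

Lemma bounded_convergence (Q : probability T R) (f_ : nat -> T -> \bar R)
    (f : T -> \bar R) :
  (forall n, measurable_fun setT (f_ n)) -> measurable_fun setT f ->
  (forall n x, 0 <= f_ n x <= 1) ->
  (forall x, f_ n x @[n --> \oo] --> f x) ->
  \int[Q]_x f_ n x @[n --> \oo] --> \int[Q]_x f x.
Proof.
move=> mf_ mf f01 ff.
have [] := @dominated_convergence _ _ _ Q setT measurableT f_ f (cst 1) mf_ mf.
- by apply: aeW => x _; exact: ff.
- apply/integrableP; split=> //.
  under eq_integral do rewrite /= normr1.
  by rewrite integral_cst//= probability_setT mule1 ltry.
- apply: aeW => x n _ /=; have /andP[? ?] := f01 n x.
  by rewrite gee0_abs.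
- by [].
Qed.

Lemma integral_prob_itv01 (Q : probability T R) (f : T -> \bar R) :
  measurable_fun setT f -> (forall x, 0 <= f x <= 1) ->
  0 <= \int[Q]_x f x <= 1.
Proof.
move=> mf f01.
have f0 x : 0 <= f x by case/andP: (f01 x).
have f1 x : f x <= 1 by case/andP: (f01 x).
rewrite integral_ge0//=.
apply: (@le_trans _ _ (\int[Q]_x 1)); first exact: ge0_le_integral.
by rewrite integral_cst//= probability_setT mule1.
Qed.

End bounded_convergence.

Lemma conv_itv01 (R : realType) (Q : probability R R) (f : R -> \bar R) u :
  measurable_fun setT f -> (forall x, 0 <= f x <= 1)%E -> (0 <= conv Q f u <= 1)%E.
Proof.
move=> mf f01; apply: integral_prob_itv01 => //.
by apply: measurableT_comp => //; exact: measurable_funB.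
Qed.

Section renewal.
Context {R : realType}.
Local Open Scope ereal_scope.
Variables (lambda : R) (E F b c : probability R R) (beta gamma : R).
Hypothesis lambda0 : (0 < lambda)%R.
Hypothesis EE : forall A, measurable A -> E A = exponential_prob lambda A.
Hypothesis F0 : F `]-oo, 0%R[%classic = 0.
Hypotheses (beta0 : (0 <= beta)%R) (gamma0 : (0 <= gamma)%R).
Hypothesis rho1 : (beta + gamma < 1)%R.
Hypothesis tail_conv_mix : forall (f : R -> \bar R) u,
  measurable_fun setT f -> (forall x, 0 <= f x) ->
  tail_conv lambda F f u = beta%:E * conv b f u + gamma%:E * conv c f u.
Variables (phi_ : nat -> R -> \bar R) (phi : R -> \bar R).
Hypothesis mphi_ : forall n, measurable_fun setT (phi_ n).
Hypothesis phi_01 : forall n x, 0 <= phi_ n x <= 1.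
Hypothesis phi_neg : forall n (x : R), (x < 0)%R -> phi_ n x = 0.
Hypothesis phi_noninc : forall n x, phi_ n.+1 x <= phi_ n x.
Hypothesis phi_nondec : forall n (x y : R), (x <= y)%R -> phi_ n x <= phi_ n y.
Hypothesis phi_rec : forall n (u : R), (0 <= u)%R ->
  phi_ n.+1 u = \int[E]_t conv F (phi_ n) (u + t)%R.
Hypothesis phi_y : forall n, phi_ n k%:R%R @[k --> \oo] --> (1 : \bar R).
Hypothesis phi_cvg : forall u, phi_ n u @[n --> \oo] --> phi u.

Let mphi : measurable_fun setT phi.
Proof. by apply: (emeasurable_fun_cvg phi_) => // x _; exact: phi_cvg. Qed.

Let phi01 x : 0 <= phi x <= 1.
Proof.
have cphi := @phi_cvg x; have /cvg_lim <- // := cphi.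
apply/andP; split.
  apply: lime_ge; first by apply/cvg_ex; eexists; exact: cphi.
  by apply: nearW => n; case/andP: (phi_01 n x).
apply: lime_le; first by apply/cvg_ex; eexists; exact: cphi.
by apply: nearW => n; case/andP: (phi_01 n x).
Qed.

Let phi_ge0 x : 0 <= phi x. Proof. by case/andP: (phi01 x). Qed.
Let phi_le1 x : phi x <= 1. Proof. by case/andP: (phi01 x). Qed.
Let phin_ge0 n x : 0 <= phi_ n x. Proof. by case/andP: (phi_01 n x). Qed.
Let phin_le1 n x : phi_ n x <= 1. Proof. by case/andP: (phi_01 n x). Qed.

Let phi_neg0 (x : R) : (x < 0)%R -> phi x = 0.
Proof.
move=> x0; have /cvg_lim <- // := @phi_cvg x.
by under eq_fun do rewrite phi_neg//; exact: lim_cst.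
Qed.

Let phi_homo (x y : R) : (x <= y)%R -> phi x <= phi y.
Proof.
move=> xy; have /cvg_lim <- // := @phi_cvg x; have /cvg_lim <- // := @phi_cvg y.
apply: lee_lim.
- by apply/cvg_ex; eexists; exact: phi_cvg.
- by apply/cvg_ex; eexists; exact: phi_cvg.
- by apply: nearW => n; exact: phi_nondec.
Qed.

Let mshift (f : R -> \bar R) (s : R) :
  measurable_fun setT f -> measurable_fun setT (fun y : R => f (s - y)%R).
Proof. by move=> mf; apply: measurableT_comp => //; exact: measurable_funB. Qed.

(** Bounded convergence, once for the convolution with [F] and once for the integral over [E],
    passes to the limit in [phi_rec]. *)
Let phi_fix (u : R) : (0 <= u)%R -> phi u = \int[E]_t conv F phi (u + t)%R.
Proof.
move=> u0; have cphi := @phi_cvg u.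
have mD (g : R -> \bar R) : measurable_fun setT g ->
    measurable_fun setT (fun t : R => g (u + t)%R).
  by move=> mg; apply: measurableT_comp => //; exact: measurable_funD.
have : phi_ n.+1 u @[n --> \oo] --> \int[E]_t conv F phi (u + t)%R.
  under eq_fun do rewrite phi_rec//.
  apply: bounded_convergence.
  - by move=> n; apply: mD; exact: measurable_conv.
  - by apply: mD; exact: measurable_conv.
  - by move=> n x; exact: conv_itv01.
  - move=> x; apply: bounded_convergence => //.
    + by move=> n; exact: mshift.
    + exact: mshift.
move/(cvg_lim (@ereal_hausdorff _)) => <-.
apply/esym/cvg_lim => //.
by rewrite (cvg_shiftS (phi_ ^~ u) (nbhs (phi u))).
Qed.

Let rho := (beta + gamma)%R.

Let mix_le (f : R -> \bar R) u : measurable_fun setT f ->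
  (forall x, 0 <= f x <= 1) -> tail_conv lambda F f u <= rho%:E.
Proof.
move=> mf f01; rewrite tail_conv_mix//; last by move=> x; case/andP: (f01 x).
rewrite EFinD; apply: leeD; rewrite -[leRHS]mule1; apply: lee_wpmul2l;
  rewrite ?lee_fin//.
  by case/andP: (conv_itv01 b u mf f01).
by case/andP: (conv_itv01 c u mf f01).
Qed.

(** At each finite horizon, [phi_] at [u] is at most its value at 0 plus [rho], and it tends to 1 as
    [u] grows. The resulting bound is uniform in the horizon. *)
Let phi_0_ge : 1 - rho%:E <= phi 0%R.
Proof.
suff H n : 1 - rho%:E <= phi_ n.+1 0%R.
  have := @phi_cvg 0%R; rewrite -(cvg_shiftS (phi_ ^~ 0%R)) => cphi.
  have /cvg_lim <- // := cphi.
  apply: lime_ge; first by apply/cvg_ex; eexists; exact: cphi.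
  exact: nearW.
rewrite leeBlDr//; have cphi := @phi_y n.+1.
have /cvg_lim <- // := cphi.
apply: lime_le; first by apply/cvg_ex; eexists; exact: cphi.
apply: nearW => k.
apply: (le_trans (le_tail_conv lambda0 EE F0 (mphi_ n) (mphi_ n.+1)
  _ _ _ _ _ _ _)) => //.
- by move=> x x0; exact: phi_neg.
- by move=> u u0; exact: phi_rec.
by apply: leeD2l; exact: mix_le.
Qed.

Let phi_tail (u : R) : (0 <= u)%R ->
  phi u = phi 0%R + (beta%:E * conv b phi u + gamma%:E * conv c phi u).
Proof.
move=> u0; rewrite -tail_conv_mix//.
by apply: (tail_convE lambda0 EE F0 mphi) => //; exact: phi_fix.
Qed.

Let phi_sup : exists2 p, (p <= 1)%R & phi x @[x --> +oo%R] --> p%:E.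
Proof.
have h : phi x @[x --> +oo%R] --> ereal_sup (range phi).
  by apply: nondecreasing_cvge => x y; exact: phi_homo.
have s0 : 0 <= ereal_sup (range phi).
  by apply: (le_trans (phi_ge0 0%R)); apply: ereal_sup_ubound; exists 0%R.
have s1 : ereal_sup (range phi) <= 1 by apply: ge_ereal_sup => _ [x _ <-].
have sfin : ereal_sup (range phi) \is a fin_num.
  by rewrite ge0_fin_numE// (le_lt_trans s1)// ltry.
exists (fine (ereal_sup (range phi))); last by rewrite fineK.
by rewrite -lee_fin fineK.
Qed.

(** Letting [u] tend to infinity in [phi_tail] gives [p = phi 0 + rho * p] with [p <= 1], so
    [phi 0 = (1 - rho) * p]. *)
Let phi_0_le : phi 0%R <= 1 - rho%:E.
Proof.
have [p p1 cphi] := phi_sup.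
have cp (y : R) : phi (k%:R - y)%R @[k --> \oo] --> p%:E.
  apply: (cvg_comp (fun k => k%:R - y)%R phi _ cphi).
  apply: (cvg_comp (fun k => k%:R)%R (fun x : R => x - y)%R cvgr_idn).
  exact: cvg_addrr.
have cp0 : phi k%:R%R @[k --> \oo] --> p%:E.
  exact: (cvg_comp _ _ cvgr_idn cphi).
have cconv (Q : probability R R) : conv Q phi k%:R%R @[k --> \oo] --> p%:E.
  have -> : p%:E = \int[Q]_y p%:E.
    by rewrite integral_cst//= probability_setT mule1.
  apply: bounded_convergence => //.
  - by move=> n; exact: mshift.
have phi0fin : phi 0%R \is a fin_num.
  by rewrite ge0_fin_numE// (le_lt_trans (phi_le1 _))// ltry.
have : phi k%:R%R @[k --> \oo] --> phi 0%R + (beta%:E * p%:E + gamma%:E * p%:E).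
  under eq_fun do rewrite phi_tail//.
  apply: cvgeD; first by rewrite fin_num_adde_defr.
    exact: cvg_cst.
  by apply: cvgeD => //; apply: cvgeZl.
move/(cvg_lim (@ereal_hausdorff _)); have /cvg_lim -> // := cp0.
rewrite -(fineK phi0fin) -!EFinM -!EFinD => -[pE].
rewrite lee_fin; move: pE; rewrite /rho. 
have := rho1; nra.
Qed.

Theorem renewal_equation (u : R) : (0 <= u)%R ->
  phi u = (1 - (beta + gamma))%:E +
          (beta%:E * conv b phi u + gamma%:E * conv c phi u).
Proof.
move=> u0; rewrite phi_tail//; congr (_ + _).
by apply/eqP; rewrite eq_le phi_0_le phi_0_ge.
Qed.

End renewal.


(** * The claim surplus random walk *)

Section walk_max.
Context {R : realType} {T : Type}.
Implicit Types (X : nat -> T -> R).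

Fixpoint walk_max X (n m : nat) (w : T) : R :=
  if n is n'.+1 then Num.max 0 (X m w + walk_max X n' m.+1 w) else 0.

Lemma walk_max_ge0 X n m w : 0 <= walk_max X n m w.
Proof. by case: n => //= n; rewrite le_max lexx. Qed.

(** This connects the recursive form, suited to conditioning, with the partial sums in which the
    supremum of the loss is expressed. *)
Lemma walk_max_le X n m w (u : R) :
  walk_max X n m w <= u <->
  (forall k, (k <= n)%N -> \sum_(i < k) X (m + i)%N w <= u).
Proof.
elim: n m u => [|n IH] m u /=.
  split=> [u0 [|//] _|/(_ 0%N)]; first by rewrite big_ord0.
  by rewrite big_ord0; exact.
rewrite ge_max -lerBrDl; split=> [/andP[u0 /IH Xu] [_|k kn]|Xu].
- by rewrite big_ord0.
- rewrite big_ord_recl/= addn0 -lerBrDl.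
  under eq_bigr do rewrite /bump/= add1n addnS -addSn.
  exact: Xu.
- apply/andP; split; first by have := Xu 0%N isT; rewrite big_ord0.
  apply/IH => k kn; have := Xu k.+1 kn.
  rewrite big_ord_recl/= addn0 -lerBrDl.
  by under eq_bigr do rewrite /bump/= add1n addnS -addSn.
Qed.

Lemma walk_max_homo X n m w : walk_max X n m w <= walk_max X n.+1 m w.
Proof.
apply/walk_max_le => k kn.
by have /walk_max_le := lexx (walk_max X n.+1 m w); apply; exact: leqW.
Qed.

End walk_max.

Lemma measurable_walk_max (R : realType) d (T : measurableType d)
    (X : nat -> T -> R) n m :
  (forall i, (m <= i)%N -> measurable_fun setT (X i)) ->
  measurable_fun setT (walk_max X n m).
Proof.
elim: n m => [|n IH] m mX; first exact: measurable_cst.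
apply: measurable_maxr; first exact: measurable_cst.
apply: measurable_funD; first exact: mX.
by apply: IH => i mi; apply: mX; exact: ltnW.
Qed.

Section random_variable_of.
Context d (T : measurableType d) (R : realType) (P : probability T R).

Definition rv_of (f : T -> R) (mf : measurable_fun setT f) : {RV P >-> R} :=
  HB.pack f (isMeasurableFun.Build _ _ _ _ f mf).

Let preimage_le (Y : {RV P >-> R}) (u : R) :
  Y @^-1` `]-oo, u] = [set w | (Y w <= u)%R].
Proof. by apply/seteqP; split=> w /=; rewrite in_itv. Qed.

Lemma measurable_rv_le (Y : {RV P >-> R}) (u : R) :
  measurable [set w | (Y w <= u)%R].
Proof. by rewrite -preimage_le -[_ @^-1` _]setTI; exact: measurable_funP. Qed.

Lemma cdf_setE (Y : {RV P >-> R}) u : cdf Y u = P [set w | (Y w <= u)%R].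
Proof. by rewrite -preimage_le. Qed.

End random_variable_of.

Section claims_walk.
Context d (T : measurableType d) (R : realType) (P : probability T R).
Local Open Scope ereal_scope.
Variables (N : R -> T -> nat) (tau U : nat -> {RV P >-> R}).
Hypothesis tau0 : forall i w, (0 <= tau i w)%R.
Hypothesis ind_tau : mutually_independent P tau.
Hypothesis N_tau : forall (t : R) w n, (0 <= t)%R ->
  (n <= N t w)%N = (\sum_(i < n) tau i w <= t)%R.
Hypothesis ind_U : mutually_independent P U.
Hypothesis indNU : independent_systems P (sigma_of [set t : R | (0 <= t)%R] N)
  (sigma_of [set: nat] (fun i => U i : T -> R)).

(** For [x >= 0] the [n]-th epoch exceeds [x] exactly off the event [n <= N x]. Epochs, and so their
    differences [tau i], are thus functions of [N], which transfers the independence of [N] and [U]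
    to [tau] and [U]. *)
Let measurable_epoch n : measurable_fun
  (setT : set (sigma_of_type [set t : R | (0 <= t)%R] N))
  (fun w => \sum_(i < n) tau i w)%R.
Proof.
apply: (measurability _ (RGenOInfty.measurableE R)) => // _ [_ [x ->] <-].
rewrite setTI; have [x0|x0] := leP 0%R x.
  rewrite (_ : _ @^-1` _ = ~` (N x @^-1` [set k | (n <= k)%N])); last first.
    apply/seteqP; split=> w /=; rewrite in_itv/= andbT N_tau// ltNge.
      by move/negP.
    by move=> ?; exact/negP.
  by apply: measurableC; apply: sigma_of_preimage => //; exact: measurable_sigma_of.
rewrite (_ : _ @^-1` _ = setT)//; apply/seteqP; split=> w //= _.
by rewrite in_itv/= andbT (lt_le_trans x0)// sumr_ge0.
Qed.

Let measurable_tau i : measurable_fun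
  (setT : set (sigma_of_type [set t : R | (0 <= t)%R] N)) (tau i).
Proof.
have -> : (tau i : T -> R) =
    ((fun w => \sum_(j < i.+1) tau j w) \- (fun w => \sum_(j < i) tau j w))%R.
  by apply/funext => w /=; rewrite big_ord_recr/= addrAC subrr add0r.
exact: (measurable_funB (measurable_epoch i.+1) (measurable_epoch i)).
Qed.

(** Interarrival times ([true]) and claims ([false]) form a single family, to which the grouping
    lemma [independent_sigma_of] applies. *)
Definition tau_or_claim (i : bool * nat) : {RV P >-> R} :=
  if i.1 then tau i.2 else U i.2.

(** A finite index list is split by its boolean tag. [indNU] factors the two groups, and each group
    factors by its own independence. *)
Lemma mutually_independent_tau_claim : mutually_independent P tau_or_claim.
Proof.
move=> J A uJ mA.
pose J1 := [seq i.2 | i <- J & i.1]; pose J2 := [seq i.2 | i <- J & ~~ i.1].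
pose C1 := \bigcap_(n in [set` J1]) (tau n @^-1` A (true, n)).
pose C2 := \bigcap_(n in [set` J2]) (U n @^-1` A (false, n)).
have mC1 : sigma_of [set t : R | (0 <= t)%R] N C1.
  apply: (@fin_bigcap_measurable _
    (sigma_of_type [set t : R | (0 <= t)%R] N)) => //.
  by move=> n _; rewrite -[_ @^-1` _]setTI; exact: measurable_tau.
have mC2 : sigma_of [set: nat] (fun i => U i : T -> R) C2.
  apply: (@fin_bigcap_measurable _
    (sigma_of_type [set: nat] (fun i => U i : T -> R))) => //.
  move=> n _; rewrite -[_ @^-1` _]setTI.
  exact: (@measurable_sigma_of _ _ _ _ _ _ (fun i => U i : T -> R)).
have memJ1 n : (n \in J1) = ((true, n) \in J).
  apply/mapP/idP => [[[[] k]]|nJ]; rewrite ?mem_filter/=; first by move=> kJ ->.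
    by [].
  by exists (true, n) => //; rewrite mem_filter.
have memJ2 n : (n \in J2) = ((false, n) \in J).
  apply/mapP/idP => [[[[] k]]|nJ]; rewrite ?mem_filter/=; first by [].
    by move=> kJ ->.
  by exists (false, n) => //; rewrite mem_filter.
have -> : \bigcap_(i in [set` J]) (tau_or_claim i @^-1` A i) = C1 `&` C2.
  apply/seteqP; split=> [w Jw|w [w1 w2] [[] n] /= iJ].
  - split=> n /=; rewrite ?memJ1 ?memJ2 => nJ; first exact: (Jw (true, n)).
    exact: (Jw (false, n)).
  - by apply: w1; rewrite /= memJ1.
  - by apply: w2; rewrite /= memJ2.
rewrite indNU// ind_tau//; last first.
  rewrite map_inj_in_uniq ?filter_uniq// => -[[] i] [[] j];
    rewrite !mem_filter//= => _ _ -> //.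
rewrite ind_U//; last first.
  rewrite map_inj_in_uniq ?filter_uniq// => -[[] i] [[] j];
    rewrite !mem_filter//= => _ _ -> //.
rewrite [RHS](bigID (fun i => i.1))/= !big_map !big_filter.
by congr (_ * _); apply: eq_bigr => -[[] i].
Qed.


Definition increment (i : nat) (w : T) : R := (U i w - tau i w)%R.

Lemma measurable_walk n m : measurable_fun setT (walk_max increment n m).
Proof. by apply: measurable_walk_max => i _; exact: measurable_funB. Qed.

Definition walk_rv n m : {RV P >-> R} := rv_of P (measurable_walk n m).

Let V := (fun i => tau_or_claim i : T -> R).

Let measurable_walk_sigma n m (D : set (bool * nat)) :
  [set i | (m <= i.2)%N] `<=` D ->
  measurable_fun (setT : set (sigma_of_type D V)) (walk_max increment n m).
Proof.
move=> mD; apply: measurable_walk_max => i mi.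
apply: measurable_funB.
  by apply: (measurable_sigma_of (X := V) (i := (false, i))); exact: mD.
by apply: (measurable_sigma_of (X := V) (i := (true, i))); exact: mD.
Qed.

Let independent_of (D1 D2 : set (bool * nat)) (Y Z : {RV P >-> R}) :
  D1 `&` D2 = set0 ->
  measurable_fun (setT : set (sigma_of_type D1 V)) Y ->
  measurable_fun (setT : set (sigma_of_type D2 V)) Z ->
  forall A B, measurable A -> measurable B ->
  P (Y @^-1` A `&` Z @^-1` B) = P (Y @^-1` A) * P (Z @^-1` B).
Proof.
move=> D12 mY mZ A B mA mB.
apply: (independent_sigma_of mutually_independent_tau_claim D12).
  exact: sigma_of_preimage.
exact: sigma_of_preimage.
Qed.

Variables E F : probability R R.
Hypothesis tauE : forall i A, measurable A -> distribution P (tau i) A = E A.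
Hypothesis UF : forall i A, measurable A -> distribution P (U i) A = F A.

(** First-step decomposition: as [u >= 0], the maximum with 0 is harmless and the event says that
    [U m] plus the later walk is at most [u + tau m]. The three ingredients depend on disjoint sets
    of indices. *)
Lemma cdf_walk_rvS n m (u : R) : (0 <= u)%R ->
  cdf (walk_rv n.+1 m) u = \int[E]_t conv F (cdf (walk_rv n m.+1)) (u + t)%R.
Proof.
move=> u0; pose Y : {RV P >-> R} := (U m + walk_rv n m.+1)%R.
have indU : forall A B, measurable A -> measurable B ->
    P (U m @^-1` A `&` walk_rv n m.+1 @^-1` B) =
    P (U m @^-1` A) * P (walk_rv n m.+1 @^-1` B).
  apply: (@independent_of [set (false, m)] [set i | (m.+1 <= i.2)%N]).
  - by apply/seteqP; split=> // i [/= ->]; rewrite /= ltnn.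
  - exact: (measurable_sigma_of (X := V) (i := (false, m))).
  - exact: measurable_walk_sigma.
have indY : forall A B, measurable A -> measurable B ->
    P (tau m @^-1` A `&` Y @^-1` B) = P (tau m @^-1` A) * P (Y @^-1` B).
  pose D := [set (false, m)] `|` [set i | (m.+1 <= i.2)%N].
  apply: (@independent_of [set (true, m)] D).
  - by apply/seteqP; split=> // i [/= ->] [//|]; rewrite /= ltnn.
  - exact: (measurable_sigma_of (X := V) (i := (true, m))).
  - apply: measurable_funD.
      by apply: (measurable_sigma_of (X := V) (i := (false, m))); left.
    by apply: measurable_walk_sigma; exact: subsetUr.
rewrite cdf_setE.
transitivity (P [set w | (Y w - tau m w <= u)%R]).
  congr (P _); apply/seteqP; split=> w /=; rewrite ge_max u0/=;
    by rewrite addrAC.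
rewrite cdf_independent_diff//.
rewrite (@eq_measure_integral _ _ _ _ E) => [|A mA _]; last exact: tauE.
apply: eq_integral => t _; rewrite cdf_setE.
rewrite -[LHS]/(P [set w | (U m w + walk_rv n m.+1 w <= u + t)%R]).
rewrite cdf_independent_sum//.
by apply: eq_measure_integral => A mA _; exact: UF.
Qed.

Lemma cdf_walk_rv_neg n m (u : R) : (u < 0)%R -> cdf (walk_rv n m) u = 0.
Proof.
move=> u0; rewrite cdf_setE (_ : [set _ | _] = set0) ?measure0//.
apply/seteqP; split=> // w /=.
by rewrite leNgt (lt_le_trans u0)// walk_max_ge0.
Qed.

(** By stationarity of the steps, the recursion for the laws has the same form at every starting
    index. *)
Lemma cdf_walk_rv_shift n m : cdf (walk_rv n m) = cdf (walk_rv n 0).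
Proof.
elim: n m => [|n IH] m; apply/funext => u.
  by rewrite !cdf_setE; congr (P _); apply/seteqP; split.
have [u0|u0] := ltP u 0%R; first by rewrite !cdf_walk_rv_neg.
by rewrite (cdf_walk_rvS n m u0) (cdf_walk_rvS n 0 u0) (IH m.+1) (IH 1%N).
Qed.

End claims_walk.

Section max_loss.
Context d (T : measurableType d) (R : realType) (P : probability T R).
Local Open Scope ereal_scope.
Variables (N : R -> T -> nat) (tau U : nat -> {RV P >-> R}).
Hypothesis tau0 : forall i w, (0 <= tau i w)%R.
Hypothesis N_tau : forall (t : R) w n, (0 <= t)%R ->
  (n <= N t w)%N = (\sum_(i < n) tau i w <= t)%R.

(* The supremum is approached just after the claims that are followed by a
   positive interarrival time. *)
Lemma max_loss_gt (u : R) w : u%:E < max_loss P N U w <->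
  exists2 n, (0 < tau n w)%R & (u < \sum_(i < n) increment tau U i w)%R.
Proof.
have incE n : (\sum_(i < n) increment tau U i w =
    \sum_(i < n) U i w - \sum_(i < n) tau i w)%R by rewrite sumrB.
split=> [/ereal_sup_gt[_ [t /= t0 <-]]|[n n0 un]].
  (* With [n = N t w], the epoch of index [n] is at most [t], so stopping there does not lower the
     loss. A zero [tau n w] would place one more claim before [t]. *)
  rewrite lte_fin => ut; exists (N t w).
    rewrite lt_neqAle tau0 andbT eq_sym; apply/eqP => tau_eq0.
    have := N_tau w (N t w).+1 t0.
    by rewrite ltnn big_ord_recr/= tau_eq0 addr0 -N_tau// leqnn.
  rewrite (lt_le_trans ut)// incE lerB//.
  by rewrite -N_tau.
have t0 : (0 <= \sum_(i < n) tau i w)%R by exact: sumr_ge0.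
(* Positivity of [tau n w] ensures that exactly [n] claims have arrived at this epoch. *)
have NE : N (\sum_(i < n) tau i w)%R w = n.
  apply/eqP; rewrite eqn_leq N_tau// lexx andbT leqNgt N_tau//.
  by rewrite big_ord_recr/= -subr_ge0 opprD addrA subrr add0r oppr_ge0 -ltNge.
apply: (@lt_le_trans _ _ ((\sum_(i < n) increment tau U i w)%R%:E)).
  by rewrite lte_fin.
apply: ereal_sup_ubound; exists (\sum_(i < n) tau i w)%R => //.
by rewrite NE incE.
Qed.

(** Stated through the walk, this is the exact limit of the finite-horizon distribution functions;
    the corresponding event for [max_loss] agrees with it only up to a null set. *)
Definition survival (u : R) : \bar R :=
  P [set w | forall n, (walk_max (increment tau U) n 0 w <= u)%R].

Let measurable_walk_le (u : R) n :
  measurable [set w | (walk_max (increment tau U) n 0 w <= u)%R].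
Proof. exact: (measurable_rv_le (walk_rv tau U n 0)). Qed.

Let survival_bigcap (u : R) :
  [set w | forall n, (walk_max (increment tau U) n 0 w <= u)%R] =
  \bigcap_n [set w | (walk_max (increment tau U) n 0 w <= u)%R].
Proof. by apply/seteqP; split=> w wu n; [move=> _|]; exact: wu. Qed.

Let measurable_survival (u : R) :
  measurable [set w | forall n, (walk_max (increment tau U) n 0 w <= u)%R].
Proof. by rewrite survival_bigcap; exact: bigcapT_measurable. Qed.

Lemma survival01 (u : R) : 0 <= survival u <= 1.
Proof. by rewrite measure_ge0; exact: probability_le1. Qed.

Lemma cdf_walk_survival (u : R) :
  cdf (walk_rv tau U n 0) u @[n --> \oo] --> survival u.
Proof.
under eq_fun do rewrite cdf_setE.
rewrite /survival survival_bigcap; apply: nonincreasing_cvg_mu => //.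
- by rewrite ltey_eq fin_num_measure.
- exact: bigcapT_measurable.
- apply/nonincreasing_seqP => n; apply/subsetPset => w /=.
  exact/le_trans/walk_max_homo.
Qed.

Hypothesis tau_gt0 : forall i, P [set w | (tau i w <= 0)%R] = 0.

(** Off the null set [Z], where some interarrival time vanishes, [max_loss_gt] says that the loss
    exceeds [u] exactly when some partial sum does. *)
Lemma max_loss_survival (u : R) :
  P [set w | u%:E < max_loss P N U w] = 1 - survival u.
Proof.
have mS := measurable_survival u; rewrite /survival -probability_setC//.
have mtau n : measurable [set w | (tau n w <= 0)%R] by exact: measurable_rv_le.
pose Z := \bigcup_n [set w | (tau n w <= 0)%R].
have mZ : measurable Z by exact: bigcupT_measurable.
have Z0 : P Z = 0.
  apply: measure_negligible => //; apply: negligible_bigcup => n.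
  by apply/(negligibleP _ (mtau n)); exact: tau_gt0.
pose S n := [set w | (u < \sum_(i < n) increment tau U i w)%R].
have mE : measurable [set w | u%:E < max_loss P N U w].
  rewrite [X in measurable X](_ : _ =
      \bigcup_n (~` [set w | (tau n w <= 0)%R] `&` S n)); last first.
    apply/seteqP; split=> w /=.
      move/max_loss_gt => [n n0 un]; exists n => //; split => //=.
      by apply/negP; rewrite -ltNge.
    move=> [n _ [/negP + un]]; rewrite -ltNge => n0.
    by apply/max_loss_gt; exists n.
  apply: bigcupT_measurable => n; apply: measurableI; first exact: measurableC.
  rewrite [X in measurable X](_ : _ =
      (fun w => \sum_(i < n) increment tau U i w)%R @^-1` `]u, +oo[).
    rewrite -[_ @^-1` _]setTI; apply: measurable_sum => // i.
    exact: measurable_funB.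
  by apply/seteqP; split=> w /=; rewrite in_itv/= andbT.
apply/eqP; rewrite eq_le; apply/andP; split.
  apply: le_measure; rewrite ?inE//; first exact: measurableC.
  move=> w /= /max_loss_gt[n _ un] wu.
  have /walk_max_le/(_ n (leqnn n)) := wu n.
  by rewrite leNgt; under eq_bigr do rewrite add0n; rewrite un.
apply: (@le_trans _ _ (P ([set w | u%:E < max_loss P N U w] `|` Z))).
  apply: le_measure; rewrite ?inE//; [exact: measurableC|exact: measurableU|].
  move=> w /= /existsNP[n]; have [wZ _|wZ wu] := pselect (Z w); first by right.
  left; apply/max_loss_gt.
  have /existsNP[k /not_implyP[kn /negP]] : ~ (forall k, (k <= n)%N ->
      (\sum_(i < k) increment tau U (0 + i)%N w <= u)%R).
    by move=> h; apply: wu; apply/walk_max_le.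
  under eq_bigr do rewrite add0n.
  rewrite -ltNge => uk; exists k => //.
  by rewrite ltNge; apply/negP => tk; apply: wZ; exists k.
by rewrite (le_trans (measureU2 _ _ _))// [X in _ + X]Z0 adde0.
Qed.

End max_loss.

(** * Survival function of the risk model *)

Section model.
Context d (T : measurableType d) (R : realType) (P : probability T R).
Local Open Scope ereal_scope.
Variables (lambda eps : R) (B C : {RV P >-> R}) (N : R -> T -> nat).
Variables (U : nat -> {RV P >-> R}) (Ce Be : {RV P >-> R}).
Let beta := ((1 - eps) * (lambda * fine 'E_P[B]))%R.
Let gamma := (eps * (lambda * fine 'E_P[C]))%R.
Hypothesis lambda0 : (0 < lambda)%R.
Hypothesis eps01 : (0 <= eps <= 1)%R.
Hypotheses (B0 : forall w, (0 <= B w)%R) (C0 : forall w, (0 <= C w)%R).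
Hypotheses (EB : 0 < 'E_P[B] < +oo) (EC : 0 < 'E_P[C] < +oo).
Hypothesis rho1 : (beta + gamma < 1)%R.
Hypothesis CL : cramer_lundberg P lambda eps B C N U.
Hypotheses (exC : has_excess_law P C Ce) (exB : has_excess_law P B Be).

Let eps0 : (0 <= eps)%R. Proof. by case/andP: eps01. Qed.
Let eps1 : (0 <= 1 - eps)%R. Proof. by case/andP: eps01; rewrite subr_ge0. Qed.

Let fineE_gt0 (X : {RV P >-> R}) : 0 < 'E_P[X] < +oo -> (0 < fine 'E_P[X])%R.
Proof. by move=> /andP[X0 Xy]; rewrite fine_gt0// X0 Xy. Qed.

Let mixture A : measurable A -> distribution P (U 0) A =
  (1 - eps)%:E * distribution P B A + eps%:E * distribution P C A.
Proof. by case: CL => _ h _ _; exact: h. Qed.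

Let ge0_itvNy0o (X : {RV P >-> R}) : (forall w, (0 <= X w)%R) ->
  distribution P X `]-oo, 0%R[%classic = 0.
Proof.
move=> X0; rewrite /distribution /pushforward (_ : _ @^-1` _ = set0) ?measure0//.
by apply/seteqP; split=> w //=; rewrite in_itv/= ltNge X0.
Qed.

Let excess_conv (X Y : {RV P >-> R}) (f : R -> \bar R) u :
  0 < 'E_P[X] < +oo -> has_excess_law P X Y ->
  measurable_fun setT f -> (forall x, 0 <= f x) ->
  \int[lebesgue_measure]_(x in `[0%R, +oo[) (f (u - x)%R * ccdf X x) =
  (fine 'E_P[X])%:E * conv (distribution P Y) f u.
Proof.
move=> EX XY mf f0; have m0 := fineE_gt0 EX.
have mfu : measurable_fun setT (fun x : R => f (u - x)%R).
  by apply: measurableT_comp => //; exact: measurable_funB.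
rewrite /conv (integral_excess XY (ltW m0) mfu)//.
by rewrite muleA -EFinM mulfV ?gt_eqF// mul1e.
Qed.

(** The claim tail is the mixture of the tails of [B] and [C], and each tail is its mean times a
    stationary excess density. *)
Let tail_conv_mixture (f : R -> \bar R) u :
  measurable_fun setT f -> (forall x, 0 <= f x) ->
  tail_conv lambda (distribution P (U 0)) f u =
  beta%:E * conv (distribution P Be) f u + gamma%:E * conv (distribution P Ce) f u.
Proof.
move=> mf f0.
have mfu : measurable_fun setT (fun x : R => f (u - x)%R).
  by apply: measurableT_comp => //; exact: measurable_funB.
have mfc (X : {RV P >-> R}) :
    measurable_fun setT (fun x : R => f (u - x)%R * ccdf X x).
  by apply: emeasurable_funM => //; exact: ccdf_measurable.
have fc0 (X : {RV P >-> R}) x : 0 <= f (u - x)%R * ccdf X x by rewrite mule_ge0.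
rewrite /tail_conv.
rewrite [X in _ * X](_ : _ = \int[lebesgue_measure]_(x in `[0%R, +oo[)
    ((1 - eps)%:E * (f (u - x)%R * ccdf B x) +
     eps%:E * (f (u - x)%R * ccdf C x))); last first.
  apply: eq_integral => x _; rewrite [X in _ * X]mixture//.
  rewrite ge0_muleDr; [|by rewrite mule_ge0// lee_fin..].
  by rewrite muleCA [X in _ + X]muleCA.
rewrite ge0_integralD//; last 4 first.
- by move=> x _; rewrite mule_ge0// lee_fin.
- by apply: measurable_funTS; apply: measurable_funeM; exact: mfc.
- by move=> x _; rewrite mule_ge0// lee_fin.
- by apply: measurable_funTS; apply: measurable_funeM; exact: mfc.
rewrite !ge0_integralZl//; [|exact: (measurable_funTS (mfc _))..].
rewrite (excess_conv u EB exB mf f0) (excess_conv u EC exC mf f0).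
rewrite ge0_muleDr; last 2 first.
- apply: mule_ge0; [by []|apply: mule_ge0; [|exact: conv_ge0]].
  by rewrite lee_fin ltW// fineE_gt0.
- apply: mule_ge0; [by []|apply: mule_ge0; [|exact: conv_ge0]].
  by rewrite lee_fin ltW// fineE_gt0.
by rewrite !muleA -!EFinM /beta /gamma ![(lambda * _)%R]mulrC -!mulrA
  ![(fine _ * lambda)%R]mulrC.
Qed.

(** The interarrival times are hidden behind the existential: only these analytic properties enter
    the perturbation argument, for [eps] and for the base model alike. *)
Lemma survival_renewal : exists Phi : R -> \bar R,
  [/\ measurable_fun setT Phi, forall x, 0 <= Phi x <= 1,
      forall x : R, (x < 0)%R -> Phi x = 0,
      forall u : R, P [set w | u%:E < max_loss P N U w] = 1 - Phi u &
      forall u : R, (0 <= u)%R -> Phi u = (1 - (beta + gamma))%:E +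
        (beta%:E * conv (distribution P Be) Phi u +
         gamma%:E * conv (distribution P Ce) Phi u)].
Proof.
case: CL => [[tau [tau0 tauE ind_tau N_tau]] UE ind_U indNU].
have tau_id i A :
    measurable A -> distribution P (tau i) A = distribution P (tau 0%N) A.
  by move=> mA; rewrite !tauE.
have U_id i A :
    measurable A -> distribution P (U i) A = distribution P (U 0%N) A.
  by move=> mA; rewrite !UE.
have tau_gt0 i : P [set w | (tau i w <= 0)%R] = 0.
  by rewrite -cdf_setE; exact: (exponential_itvNy0 (tauE i)).
have cS := @cdf_walk_survival _ _ _ P tau U.
exists (survival tau U); split.
- apply: (emeasurable_fun_cvg (fun n => cdf (walk_rv tau U n 0))) => [n|x _].
    exact: cdf_measurable.
  exact: cS.
- exact: survival01.
- move=> x x0; have /cvg_lim <- // := @cS x.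
  by under eq_fun do rewrite cdf_walk_rv_neg//; exact: lim_cst.
- by move=> u; exact: max_loss_survival.
- move=> u u0.
  apply: (@renewal_equation _ lambda (distribution P (tau 0%N))
    (distribution P (U 0%N)) _ _ beta gamma lambda0 (tauE 0%N) _ _ _ rho1 tail_conv_mixture
    (fun n => cdf (walk_rv tau U n 0))) => //.
  + by rewrite [LHS]mixture// !ge0_itvNy0o// !mule0 adde0.
  + by rewrite /beta !mulr_ge0// ltW// fineE_gt0.
  + by rewrite /gamma !mulr_ge0// ltW// fineE_gt0.
  + by move=> n; exact: cdf_measurable.
  + by move=> n x; rewrite cdf_ge0 cdf_le1.
  + by move=> n x x0; exact: cdf_walk_rv_neg.
  + move=> n x; rewrite !cdf_setE.
    apply: le_measure; rewrite ?inE; [exact: measurable_rv_le..|].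
    by move=> w /=; exact/le_trans/walk_max_homo.
  + by move=> n x y; exact: cdf_nondecreasing.
  + move=> n v v0.
    rewrite (cdf_walk_rvS tau0 ind_tau N_tau ind_U indNU tau_id U_id)//.
    by rewrite (cdf_walk_rv_shift tau0 ind_tau N_tau ind_U indNU tau_id U_id).
  + by move=> n; exact: (cvg_comp _ _ cvgr_idn (cvg_cdfy1 _)).
Qed.

End model.


(** * Perturbation of the renewal equation *)

Section conv_prob.
Context {R : realType}.
Local Open Scope ereal_scope.
Implicit Types (Q : probability R R) (f g : R -> \bar R).

(** A sup-norm bound is expressed by two such one-sided inequalities, which avoids subtracting
    extended reals. *)
Lemma conv_le_add Q f g (k : R) u :
  measurable_fun setT f -> measurable_fun setT g ->
  (forall x, 0 <= f x) -> (forall x, 0 <= g x) -> (0 <= k)%R ->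
  (forall x, f x <= g x + k%:E) -> conv Q f u <= conv Q g u + k%:E.
Proof.
move=> mf mg f0 g0 k0 fg.
have mfu : measurable_fun setT (fun x : R => f (u - x)%R).
  by apply: measurableT_comp => //; exact: measurable_funB.
have mgu : measurable_fun setT (fun x : R => g (u - x)%R).
  by apply: measurableT_comp => //; exact: measurable_funB.
have -> : k%:E = \int[Q]_y k%:E.
  by rewrite integral_cst//= probability_setT mule1.
rewrite -ge0_integralD//.
apply: ge0_le_integral => //; exact: emeasurable_funD.
Qed.

Lemma conv_heaviside Q u :
  conv Q (fun x => (\1_`[0%R, +oo[ x)%:E) u = Q `]-oo, u]%classic.
Proof.
rewrite /conv; under eq_integral => y _.
  rewrite (_ : \1_`[0%R, +oo[ (u - y)%R = \1_`]-oo, u] y); last first.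
    by rewrite !indicE; congr (_%:R); rewrite !mem_setE !in_itv/= andbT subr_ge0.
  over.
by rewrite integral_indic// setIT.
Qed.

Lemma convD Q f g u : measurable_fun setT f -> measurable_fun setT g ->
  (forall x, 0 <= f x) -> (forall x, 0 <= g x) ->
  conv Q (fun x => f x + g x) u = conv Q f u + conv Q g u.
Proof.
move=> mf mg f0 g0; rewrite /conv ge0_integralD//;
  by apply: measurableT_comp => //; exact: measurable_funB.
Qed.

Lemma convZl Q (k : R) f u : measurable_fun setT f ->
  (forall x, 0 <= f x) -> (0 <= k)%R ->
  conv Q (fun x => k%:E * f x) u = k%:E * conv Q f u.
Proof.
move=> mf f0 k0; rewrite /conv ge0_integralZl//.
by apply: measurableT_comp => //; exact: measurable_funB.
Qed.

(* A law whose distribution function solves a renewal equation solves the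
   corresponding equation between measures. *)
Lemma conv_renewal (M b : probability R R) (delta : R) f u :
  (0 <= delta <= 1)%R ->
  (forall v : R, M `]-oo, v]%classic = ((1 - delta) * \1_`[0%R, +oo[ v)%:E +
    delta%:E * conv b (fun x => M `]-oo, x]%classic) v) ->
  measurable_fun setT f -> (forall x, 0 <= f x) ->
  conv M f u = (1 - delta)%:E * f u + delta%:E * conv M (conv b f) u.
Proof.
move=> /andP[d0]; rewrite -subr_ge0 => d1 ME mf f0.
have msum : measurable_fun setT (fun z : R * R => (z.1 + z.2)%R).
  exact: measurable_funD.
(* [mix] is [1 - delta] times the Dirac mass at 0 plus [delta] times the law of an independent sum
   from [b] and [M]. By the hypothesis on [M] the two have the same distribution function, so
   integrals against [M] may be taken against [mix]. *)
pose sum := distribution (b \x M) (rv_of (b \x M) msum).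
pose mix :=
  measure_add (mscale (NngNum d1) (\d_(0%R : R))) (mscale (NngNum d0) sum).
have m0u : measurable_fun setT (fun x : R => f (u - x)%R).
  by apply: measurableT_comp => //; exact: measurable_funB.
transitivity (\int[mix]_x f (u - x)%R).
  apply: eq_measure_integral => A mA _; apply: measure_cdf_unique => //.
    by rewrite [ltLHS]probability_setT ltry.
  move=> v; rewrite [LHS]ME [RHS]measure_addE /mscale/=.
  congr (_ + _ * _).
    rewrite EFinM /dirac !indicE; congr (_ * (_%:R)%:E).
    by rewrite !mem_setE !in_itv/= andbT.
  apply: eq_integral => x _; congr (M _).
  apply/seteqP; split=> y; rewrite /xsection/= inE/= !in_itv/= lerBrDl;
    exact.
rewrite ge0_integral_measure_add//= !ge0_integral_mscale//=.
rewrite integral_dirac// diracT mul1e subr0; congr (_ + _ * _).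
rewrite ge0_integral_distribution//=.
rewrite (@fubini_tonelli2 _ _ _ _ _ b M (fun z : R * R => f (u - (z.1 + z.2))%R)).
- by apply: eq_integral => y _; apply: eq_integral => x _;
    rewrite /= opprD addrA addrAC.
- apply: (measurableT_comp (f := fun x : R => f (u - x)%R)) => //.
- by move=> z; exact: f0.
Qed.

End conv_prob.

Section perturbation.
Context {R : realType}.
Variables (eps delta theta : R) (M b c : probability R R).
Variables (Phi Phi0 : R -> \bar R).
Let a := eps / (1 - delta).
Let q := a * (delta + theta).
Let beta := (1 - eps) * delta.
Let gamma := eps * theta.
Hypotheses (eps01 : 0 <= eps <= 1) (delta0 : 0 < delta) (theta0 : 0 < theta).
Hypotheses (delta1 : delta < 1) (q1 : q < 1).
Hypothesis rho1 : beta + gamma < 1.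
Hypotheses (mPhi : measurable_fun setT Phi) (mPhi0 : measurable_fun setT Phi0).
Hypotheses (Phi01 : forall x, (0 <= Phi x <= 1)%E).
Hypotheses (Phi001 : forall x, (0 <= Phi0 x <= 1)%E).
Hypotheses (Phi_neg : forall x, x < 0 -> Phi x = 0%E).
Hypotheses (Phi0_neg : forall x, x < 0 -> Phi0 x = 0%E).
Hypotheses (b0 : b `]-oo, 0%R[%classic = 0%E) (c0 : c `]-oo, 0%R[%classic = 0%E).
Hypothesis PhiE : forall u, 0 <= u -> (Phi u = (1 - (beta + gamma))%:E +
  (beta%:E * conv b Phi u + gamma%:E * conv c Phi u))%E.
Hypothesis Phi0E : forall u, 0 <= u ->
  (Phi0 u = (1 - delta)%:E + delta%:E * conv b Phi0 u)%E.
Hypothesis MPhi0 : forall u, M `]-oo, u]%classic = Phi0 u.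

Let Phi_ge0 x : (0 <= Phi x)%E. Proof. by case/andP: (Phi01 x). Qed.
Let Phi0_ge0 x : (0 <= Phi0 x)%E. Proof. by case/andP: (Phi001 x). Qed.
Let delta_ge0 : 0 <= delta. Proof. exact: ltW. Qed.
Let eps_ge0 : 0 <= eps. Proof. by case/andP: eps01. Qed.
Let beta_ge0 : 0 <= beta.
Proof. by case/andP: eps01 => _ ?; rewrite mulr_ge0// subr_ge0. Qed.
Let gamma_ge0 : 0 <= gamma. Proof. by rewrite mulr_ge0// ltW. Qed.
Let a_ge0 : 0 <= a. Proof. by rewrite divr_ge0// subr_ge0 ltW. Qed.
Let q_ge0 : 0 <= q. Proof. by rewrite mulr_ge0// addr_ge0// ltW. Qed.

Let conv_neg (Q : probability R R) (f : R -> \bar R) u :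
  Q `]-oo, 0%R[%classic = 0%E -> measurable_fun setT f -> (forall x, 0 <= f x)%E ->
  (forall x, x < 0 -> f x = 0%E) -> u < 0 -> conv Q f u = 0%E.
Proof.
move=> Q0 mf f0 fneg u0; rewrite /conv ge0_integral_support//.
  apply: integral0_eq => y /=; rewrite in_itv/= andbT => y0.
  by rewrite fneg// subr_lt0 (lt_le_trans u0).
by apply: measurableT_comp => //; exact: measurable_funB.
Qed.

(** The equation is extended to negative arguments, where both sides vanish, because convolution
    with [M] evaluates it at every [u - y]. *)
Let Phi_renewal u : (Phi u = (1 - (beta + gamma))%:E * (\1_`[0%R, +oo[ u)%:E +
  (beta%:E * conv b Phi u + gamma%:E * conv c Phi u))%E.
Proof.
have [u0|u0] := leP 0 u.
  by rewrite PhiE// indicE mem_set/= ?in_itv/= ?u0// mule1.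
rewrite Phi_neg// !conv_neg// !mule0 !adde0 indicE memNset ?mule0//=.
by rewrite in_itv/= leNgt u0.
Qed.

Let M_renewal f u : measurable_fun setT f -> (forall x, 0 <= f x)%E ->
  (conv M f u = (1 - delta)%:E * f u + delta%:E * conv M (conv b f) u)%E.
Proof.
apply: conv_renewal; first by rewrite delta_ge0 ltW.
move=> v; rewrite MPhi0 (_ : (fun x => _) = Phi0); last first.
  by apply/funext => x; rewrite MPhi0.
have [v0|v0] := leP 0 v.
  by rewrite Phi0E// indicE mem_set/= ?in_itv/= ?v0// mulr1.
rewrite Phi0_neg// conv_neg// mule0 adde0 indicE memNset ?mulr0//=.
by rewrite in_itv/= leNgt v0.
Qed.

Let fin01 (x : \bar R) : (0 <= x <= 1)%E -> x = (fine x)%:E.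
Proof.
move=> /andP[x0 x1]; rewrite fineK// ge0_fin_numE//.
by rewrite (le_lt_trans x1)// ltry.
Qed.

(** A real-valued form, so that differences may be taken; the contraction [K] is [a * theta] times
    the case [c] minus [a * delta] times the case [b]. *)
Let smoothed (Q : probability R R) f u := fine (conv M (conv Q f) u).

Let smoothedE (Q : probability R R) f u : measurable_fun setT f ->
  (forall x, 0 <= f x <= 1)%E -> conv M (conv Q f) u = (smoothed Q f u)%:E.
Proof.
move=> mf f01; apply: fin01; apply: conv_itv01 => [|x].
  by apply: measurable_conv => // x; case/andP: (f01 x).
exact: conv_itv01.
Qed.

Let fPhi u := fine (Phi u).
Let fPhi0 u := fine (Phi0 u).

(** [conv M Phi] is computed twice: by [M_renewal], and by applying [M] to [Phi_renewal], where the
    constant term becomes [Phi0]. The two terms in [b] combine with coefficient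
    [beta - delta = - eps * delta]. *)
Let fixpoint_Phi u :
  (1 - delta) * fPhi u = (1 - (beta + gamma)) * fPhi0 u +
    (gamma * smoothed c Phi u - eps * delta * smoothed b Phi u).
Proof.
have := M_renewal u mPhi Phi_ge0.
have -> : conv M Phi u = ((1 - (beta + gamma))%:E * Phi0 u +
    (beta%:E * conv M (conv b Phi) u + gamma%:E * conv M (conv c Phi) u))%E.
  have mcv (Q : probability R R) : measurable_fun setT (conv Q Phi).
    exact: measurable_conv.
  have cv0 (Q : probability R R) x : (0 <= conv Q Phi x)%E by exact: conv_ge0.
  rewrite -MPhi0 -conv_heaviside.
  have mh : measurable_fun setT (fun x : R => (\1_`[0%R, +oo[ x)%:E : \bar R).
    exact/measurable_EFinP/measurable_indic.
  have rho_ge0 : 0 <= 1 - (beta + gamma) by rewrite subr_ge0 ltW.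
  rewrite -(convZl _ _ _ _ rho_ge0)// -!(convZl M u (mcv _) (cv0 _))//.
  rewrite -convD//; [|exact: measurable_funeM|exact: measurable_funeM
    |by move=> x; apply: mule_ge0|by move=> x; apply: mule_ge0].
  rewrite -convD//; last first.
  - by move=> x; apply: adde_ge0; apply: mule_ge0.
  - by move=> x; apply: mule_ge0; rewrite lee_fin.
  - by apply: emeasurable_funD; exact: measurable_funeM.
  - exact: measurable_funeM.
  by apply: eq_integral => y _; rewrite Phi_renewal.
rewrite !smoothedE// (fin01 (Phi01 u)) (fin01 (Phi001 u)) -!EFinM -!EFinD => -[].
rewrite -/(fPhi u) -/(fPhi0 u) /beta => H; nra.
Qed.

(** Convolution with probability laws is nonexpansive in the sup norm. *)
Let bounded_gap (k : R) (Q : probability R R) u : 0 <= k ->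
  (forall x, `|fPhi x - fPhi0 x| <= k) ->
  `|smoothed Q Phi u - smoothed Q Phi0 u| <= k.
Proof.
move=> k0 gap.
have mcv (f : R -> \bar R) : measurable_fun setT f -> (forall x, 0 <= f x)%E ->
    measurable_fun setT (conv Q f) by exact: measurable_conv.
have le1 x : (Phi x <= Phi0 x + k%:E)%E.
  rewrite (fin01 (Phi01 x)) (fin01 (Phi001 x)) -EFinD lee_fin -lerBlDl.
  exact: le_trans (ler_norm _) (gap x).
have le2 x : (Phi0 x <= Phi x + k%:E)%E.
  rewrite (fin01 (Phi01 x)) (fin01 (Phi001 x)) -EFinD lee_fin -lerBlDl.
  by rewrite (le_trans (ler_norm _))// distrC gap.
rewrite ler_norml; apply/andP; split.
  rewrite lerNl opprB lerBlDl -lee_fin EFinD -!smoothedE//.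
  apply: conv_le_add => //; [exact: mcv|exact: mcv|by move=> x; exact: conv_ge0..|].
  by move=> x; apply: conv_le_add.
rewrite lerBlDl -lee_fin EFinD -!smoothedE//.
apply: conv_le_add => //; [exact: mcv|exact: mcv|by move=> x; exact: conv_ge0..|].
by move=> x; apply: conv_le_add.
Qed.

Let smoothed_itv01 (Q : probability R R) u : 0 <= smoothed Q Phi0 u <= 1.
Proof.
have : (0 <= conv M (conv Q Phi0) u <= 1)%E.
  apply: conv_itv01 => [|x]; first exact: measurable_conv.
  exact: conv_itv01.
by rewrite smoothedE// !lee_fin.
Qed.

Let fPhi_itv01 u : 0 <= fPhi u <= 1.
Proof. by have := Phi01 u; rewrite (fin01 (Phi01 u)) !lee_fin. Qed.

Let fPhi0_itv01 u : 0 <= fPhi0 u <= 1.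
Proof. by have := Phi001 u; rewrite (fin01 (Phi001 u)) !lee_fin. Qed.

(** The surplus coefficient of [Phi0], namely [eps * delta - eps * theta], is exactly what centres
    both smoothed terms at [Phi0]. *)
Let gapE u : fPhi u - fPhi0 u =
  a * theta * (smoothed c Phi u - fPhi0 u) -
  a * delta * (smoothed b Phi u - fPhi0 u).
Proof.
have d1 : 1 - delta != 0 by rewrite subr_eq0 gt_eqF.
apply: (mulfI d1).
have -> : (1 - delta) * (fPhi u - fPhi0 u) =
    eps * theta * (smoothed c Phi u - fPhi0 u) -
    eps * delta * (smoothed b Phi u - fPhi0 u).
  by rewrite mulrBr fixpoint_Phi /beta /gamma; ring.
by rewrite /a; field.
Qed.

Let le_combination (x y k : R) : `|x| <= k -> `|y| <= k ->
  `|a * theta * x - a * delta * y| <= q * k.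
Proof.
move=> xk yk; rewrite (le_trans (ler_normB _ _))//.
have at0 : 0 <= a * theta by rewrite mulr_ge0// ltW.
have ad0 : 0 <= a * delta by rewrite mulr_ge0.
rewrite (normrM (a * theta)) (normrM (a * delta)) (ger0_norm at0) (ger0_norm ad0).
have -> : q * k = a * theta * k + a * delta * k by rewrite /q; ring.
by apply: lerD; exact: ler_wpM2l.
Qed.

Let gap_le u : `|fPhi u - fPhi0 u| <= q / (1 - q).
Proof.
pose G := [set `|fPhi u - fPhi0 u| | u in [set: R]].
have G0 : G !=set0 by exists `|fPhi 0 - fPhi0 0|, 0.
(* Both functions lie between 0 and 1; this a priori bound makes [sup G] a genuine supremum. *)
have Gub : has_ubound G.
  exists 1 => _ [v _ <-]; have := fPhi_itv01 v; have := fPhi0_itv01 v.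
  by rewrite ler_norml => /andP[? ?] /andP[? ?]; apply/andP; split; lra.
pose k := sup G.
have gk v : `|fPhi v - fPhi0 v| <= k by apply: ub_le_sup => //; exists v.
have k0 : 0 <= k by exact: le_trans (normr_ge0 _) (gk 0).
(* [Phi] is exchanged for [Phi0] under the smoothing at cost [k]; the remaining difference of two
   numbers in the unit interval costs 1. *)
have near (Q : probability R R) v : `|smoothed Q Phi v - fPhi0 v| <= k + 1.
  have -> : smoothed Q Phi v - fPhi0 v =
    (smoothed Q Phi v - smoothed Q Phi0 v) + (smoothed Q Phi0 v - fPhi0 v) by ring.
  rewrite (le_trans (ler_normD _ _))// lerD//; first exact: bounded_gap.
  have := smoothed_itv01 Q v; have := fPhi0_itv01 v.
  by rewrite ler_norml => /andP[? ?] /andP[? ?]; apply/andP; split; lra.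
(* Taking the supremum in [gapE] gives [k <= q * (k + 1)], which [q < 1] allows to be solved for
   [k]. *)
have kq : k <= q * (k + 1).
  apply: ge_sup => // _ [v _ <-]; rewrite gapE; exact: le_combination.
apply: (le_trans (gk u)); rewrite ler_pdivlMr ?subr_gt0//; lra.
Qed.

(** By [gapE] the terms in [Phi0] alone cancel and leave [K] applied to the gap; one more factor [q]
    is gained over [gap_le]. *)
Lemma perturbation_bound u :
  `|fine (Phi u) - (fine (Phi0 u)
    + a * theta * (fine (conv M (conv c Phi0) u) - fine (Phi0 u))
    - a * delta * (fine (conv M (conv b Phi0) u) - fine (Phi0 u)))| <=
  q ^+ 2 / (1 - q).
Proof.
have k0 : 0 <= q / (1 - q) by rewrite divr_ge0// subr_ge0 ltW.
rewrite (_ : _ - _ = a * theta * (smoothed c Phi u - smoothed c Phi0 u) -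
    a * delta * (smoothed b Phi u - smoothed b Phi0 u)); last first.
  rewrite -[fine (Phi u)]/(fPhi u) -[fPhi u](subrK (fPhi0 u)) gapE.
  by rewrite -/(smoothed c Phi0 u) -/(smoothed b Phi0 u) -/(fPhi0 u); ring.
rewrite expr2 -(mulrA q); apply: le_combination;
  by apply: bounded_gap => // x; exact: gap_le.
Qed.

End perturbation.

(** * Terms of the corrected approximation and the final bound *)

Section corrected_terms.
Context d (T : measurableType d) (R : realType) (P : probability T R).
Local Open Scope ereal_scope.

Lemma tail_finE (Y : {RV P >-> R}) u :
  tail P (fun w => (Y w)%:E) u = (1 - fine (cdf Y u))%R.
Proof.
rewrite /tail (_ : [set w | _] = ~` [set w | (Y w <= u)%R]); last first.
  by apply/seteqP; split=> w /=; rewrite lte_fin ltNge => /negP.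
rewrite probability_setC; last exact: measurable_rv_le.
by rewrite -cdf_setE fineB ?fin_num_measure.
Qed.

Lemma copy_of_cdf (X : T -> \bar R) (M : {RV P >-> R}) (Phi : R -> \bar R) u :
  copy_of P X M -> P [set w | u%:E < X w] = 1 - Phi u ->
  0 <= Phi u <= 1 -> cdf M u = Phi u.
Proof.
move=> XM Xu /andP[Phi0 Phi1].
have Phifin : Phi u \is a fin_num.
  by rewrite ge0_fin_numE// (le_lt_trans Phi1)// ltry.
have : 1 - cdf M u = 1 - Phi u.
  rewrite -Xu -ccdf_1_cdf -[RHS]/(P (X @^-1` [set x | u%:E < x])) -XM.
    rewrite /ccdf /distribution /pushforward; congr (P _).
    by apply/seteqP; split=> w /=; rewrite in_itv/= andbT lte_fin.
  rewrite (_ : [set x | _] = `]u%:E, +oo[%classic); first exact: emeasurable_itv.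
  by apply/seteqP; split=> x /=; rewrite in_itv/= andbT.
rewrite -[in X in X -> _](fineK Phifin).
rewrite -[cdf M u](@fineK _ (cdf M u)) ?fin_num_measure// => -[].
by move=> /(congr1 (fun x => 1 - x)%R); rewrite !subKr => ->; rewrite fineK.
Qed.

(** The sum is regrouped as [M' + (Y + M)], so that two pairwise independences suffice and the
    distribution function of [M] is the innermost factor. *)
Lemma tail_sum3 (M M' Y : {RV P >-> R}) u :
  (forall A B, measurable A -> measurable B ->
     P (Y @^-1` A `&` M @^-1` B) = P (Y @^-1` A) * P (M @^-1` B)) ->
  (forall A B, measurable A -> measurable B ->
     P (M' @^-1` A `&` (Y + M)%R @^-1` B) = P (M' @^-1` A) * P ((Y + M)%R @^-1` B)) ->
  tail P (fun w => (M w + M' w + Y w)%:E) u =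
  (1 - fine (conv (distribution P M') (conv (distribution P Y) (cdf M)) u))%R.
Proof.
move=> YM M'YM.
transitivity (tail P (fun w => ((M' + (Y + M))%R w)%:E) u).
  by rewrite /tail; congr (fine (P _)); apply/seteqP; split=> w /=;
    rewrite [(M w + M' w)%R]addrC -addrA [(M w + Y w)%R]addrC.
rewrite tail_finE; congr (1 - fine _)%R; rewrite cdf_setE.
rewrite -[LHS]/(P [set w | (M' w + (Y + M)%R w <= u)%R]) cdf_independent_sum//.
by apply: eq_integral => y _; rewrite cdf_setE -cdf_independent_sum.
Qed.

End corrected_terms.

Theorem theorem4 (R : realType) (d : measure_display) (T : measurableType d)
  (P : probability T R) (lambda eps : R) (B C : {RV P >-> R})
  (N : R -> T -> nat) (U : nat -> {RV P >-> R})
  (N0 : R -> T -> nat) (U0 : nat -> {RV P >-> R})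
  (M00 M01 Ce1 Be1 : {RV P >-> R})
  (delta := lambda * fine 'E_P[B]) (theta := lambda * fine 'E_P[C])
  (rho := (1 - eps) * delta + eps * theta) :
  0 < lambda -> 0 <= eps <= 1 ->
  (forall w, 0 <= B w) -> (forall w, 0 <= C w) ->
  phase_type P B -> heavy_tailed P C ->
  (0 < 'E_P[B] < +oo)%E -> (0 < 'E_P[C] < +oo)%E ->
  rho < 1 -> delta < 1 ->
  cramer_lundberg P lambda eps B C N U ->
  cramer_lundberg P lambda 0 B C N0 U0 ->
  copy_of P (max_loss P N0 U0) M00 ->
  copy_of P (max_loss P N0 U0) M01 ->
  has_excess_law P C Ce1 -> has_excess_law P B Be1 ->
  mutually_independent P
    (fun i : 'I_4 => nth M00 [:: M00; M01; Ce1; Be1] i) ->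
  eps < `|1 - delta| / (delta + theta) ->
  forall u : R, 0 <= u ->
    `| ruin_prob P N U u
       - corrected_replace P lambda eps B C N0 U0 M00 M01 Ce1 Be1 u |
    <= (eps / (1 - delta)) ^+ 2 * (delta + theta) ^+ 2
       * ((1 - delta) / (1 - delta - eps * (delta + theta))).
Proof.
move=> lambda0 eps01 B0 C0 _ _ EB EC rho1 delta1 CL CL0 copy00 copy01 exC exB ind.
have mean_gt0 (X : {RV P >-> R}) :
    (0 < 'E_P[X] < +oo)%E -> 0 < lambda * fine 'E_P[X].
  by move=> /andP[X0 Xy]; rewrite mulr_gt0// fine_gt0// X0 Xy.
have delta0 : 0 < delta by exact: mean_gt0.
have theta0 : 0 < theta by exact: mean_gt0.
have d1 : 0 < 1 - delta by rewrite subr_gt0.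
rewrite (gtr0_norm d1) ltr_pdivlMr ?addr_gt0// => eps_lt u u0.
have [Phi [mPhi Phi01 Phi_neg PhiM PhiE]] :=
  survival_renewal lambda0 eps01 B0 C0 EB EC rho1 CL exC exB.
have zero01 : 0 <= (0 : R) <= 1 by rewrite lexx ler01.
have rho01 : (1 - 0) * delta + 0 * theta < 1 by rewrite mul0r addr0 subr0 mul1r.
have [Phi0 [mPhi0 Phi001 Phi0_neg Phi0M Phi0E]] :=
  survival_renewal lambda0 zero01 B0 C0 EB EC rho01 CL0 exC exB.
have cdf00 : cdf M00 = Phi0.
  by apply/funext => v; exact: copy_of_cdf copy00 (Phi0M v) (Phi001 v).
have cdf01 v : distribution P M01 `]-oo, v]%classic = Phi0 v.
  exact: copy_of_cdf copy01 (Phi0M v) (Phi001 v).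
have Phi0E' v : 0 <= v ->
    (Phi0 v = (1 - delta)%:E + delta%:E * conv (distribution P Be1) Phi0 v)%E.
  move=> v0; rewrite [LHS]Phi0E// -/delta -/theta.
  by rewrite mul0r mul0e adde0 addr0 subr0 mul1r.
(* The smallness condition on [eps] is precisely that the contraction ratio is below 1. *)
have a_lt : eps / (1 - delta) * (delta + theta) < 1.
  by rewrite mulrAC ltr_pdivrMr// mul1r.
have := perturbation_bound eps01 delta0 theta0 delta1 a_lt rho1 mPhi mPhi0
  Phi01 Phi001 Phi_neg Phi0_neg (excess_itvNy0o exB) (excess_itvNy0o exC)
  PhiE Phi0E' cdf01 u.
pose fam (i : 'I_4) : {RV P >-> R} := nth M00 [:: M00; M01; Ce1; Be1] i.
pose X i : T -> R := fam i.
pose i0 : 'I_4 := ord0; pose i1 : 'I_4 := @Ordinal 4 1 isT.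
(* [M01] supplies the outer convolving law and [M00] the inner distribution function [Phi0]; [j]
   ranges over the two excess variables. *)
have tail3 j : j != i0 -> j != i1 ->
    tail P (fun w => (M00 w + M01 w + fam j w)%:E) u = 1 - fine
      (conv (distribution P M01) (conv (distribution P (fam j)) Phi0) u).
  move=> j0 j1; rewrite -cdf00; apply: tail_sum3 => A B' mA mB.
    have disj : [set j] `&` [set i0] = set0.
      by apply/seteqP; split=> // i [-> /eqP]; rewrite (negbTE j0).
    apply: (independent_sigma_of ind disj); apply: sigma_of_preimage => //.
      exact: (measurable_sigma_of (X := X) (i := j)).
    exact: (measurable_sigma_of (X := X) (i := i0)).
  have disj : [set i1] `&` [set j; i0] = set0.
    apply/seteqP; split=> // i [-> []] => [i1j|//].
    by move: j1; rewrite i1j eqxx.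
  apply: (independent_sigma_of ind disj); apply: sigma_of_preimage => //.
    exact: (measurable_sigma_of (X := X) (i := i1)).
  apply: measurable_funD.
    by apply: (measurable_sigma_of (X := X) (i := j)); left.
  by apply: (measurable_sigma_of (X := X) (i := i0)); right.
rewrite /corrected_replace -/delta -/theta.
rewrite (tail3 (@Ordinal 4 2 isT))// (tail3 (@Ordinal 4 3 isT))// tail_finE cdf00.
rewrite /ruin_prob /tail PhiM Phi0M.
have fineB1 (x : \bar R) : (0 <= x <= 1)%E -> fine (1 - x)%E = 1 - fine x.
  move=> /andP[x0 x1]; rewrite fineB// ge0_fin_numE//.
  by rewrite (le_lt_trans x1)// ltry.
rewrite !fineB1//.
have q_neq : 1 - delta - eps * (delta + theta) != 0.
  by rewrite gt_eqF// subr_gt0.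
have rhsE : (eps / (1 - delta) * (delta + theta)) ^+ 2 /
    (1 - eps / (1 - delta) * (delta + theta)) =
    (eps / (1 - delta)) ^+ 2 * (delta + theta) ^+ 2
       * ((1 - delta) / (1 - delta - eps * (delta + theta))).
  by field; rewrite q_neq gt_eqF.
(* Tails are complements of distribution functions, and the centred corrections contain no constant,
   so the error for the ruin probability is the negative of the error for survival. *)
rewrite rhsE => bound; rewrite -normrN; apply: le_trans bound.
rewrite le_eqVlt; apply/orP; left; apply/eqP; congr (`| _ |).
by field; rewrite gt_eqF.
Qed.
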